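(* Let $p\in(0,1)$ and $0<\beta<\dfrac{p}{1-p}$. Then $$0<P(S_\infty=+\infty)<1$$ and $$P\Bigl(M_\infty>0 \ \text{ and }\ S_n\sim C(p,\beta)\,M_\infty\, n^{p(\beta+1)-\beta}\ \text{ as } n\to\infty\ \Bigm|\ S_\infty=+\infty\Bigr)=1 .$$
   Context: Unidirectional elephant random walk with power law memory. For $\beta>-1$ put $\mu_n=\dfrac{\Gamma(n+\beta)}{\Gamma(n)\Gamma(\beta+1)}$, $n\in\mathbb{N}=\{1,2,\dots\}$. Let $\{\beta_{n+1}:n\in\mathbb{N}\}$ be independent random variables with $P(\beta_{n+1}=k)=\dfrac{\beta+1}{n}\cdot\dfrac{\mu_k}{\mu_{n+1}}$ for $1\le k\le n$ and $0$ otherwise (these sum to $1$ since $\sum_{\ell=1}^n\mu_\ell=\frac{n}{\beta+1}\mu_{n+1}$). Put $X_1\equiv 1$ and, for $n\ge1$, $X_{n+1}=X_{\beta_{n+1}}$ with probability $p$ and $X_{n+1}=0$ with probability $1-p$ (the choices at different times being independent of each other and of the $\beta_{n+1}$'s). Let $S_0=0$, $S_n=\sum_{k=1}^n X_k$, and $S_\infty=\lim_{n\to\infty}S_n\in\mathbb{N}\cup\{+\infty\}$. Let $\Sigma_n=\sum_{k=1}^n\mu_kX_k$, and for $\gamma>-1$ let $c_n(\gamma)=\dfrac{\Gamma(n+\gamma)}{\Gamma(n)\Gamma(\gamma+1)}$. The process $M_n=\Sigma_n/c_n(p(\beta+1))$ is a non-negative martingale, and $M_\infty=\lim_{n\to\infty}M_n$,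 which exists almost surely. The constant is $C(p,\beta)=\dfrac{1}{p(\beta+1)-\beta}\cdot\dfrac{\Gamma(\beta+1)}{\Gamma(p(\beta+1))}$. The notation $a_n\sim b_n$ means $a_n/b_n\to1$ as $n\to\infty$. *)

(* Defs.v *)
From HB Require Import structures.
From mathcomp Require Import all_boot all_order all_algebra finmap.
From mathcomp Require Import all_classical all_reals all_analysis.

Set Implicit Arguments.
Unset Strict Implicit.
Unset Printing Implicit Defensive.

Import Order.TTheory GRing.Theory Num.Theory.
Import numFieldTopology.Exports numFieldNormedType.Exports.

Local Open Scope classical_set_scope.
Local Open Scope ring_scope.

(* Euler's integral; it is the Gamma function for x > 0, the only arguments
   needed below. *)
Definition Gamma (R : realType) (x : R) : R :=
  \int[@lebesgue_measure R]_(t in `]0, +oo[) (t `^ (x - 1) * expR (- t)).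

Definition cn (R : realType) (gamma : R) (n : nat) : R :=
  Gamma (n%:R + gamma) / (Gamma n%:R * Gamma (gamma + 1)).

Definition mun (R : realType) (beta : R) (n : nat) : R :=
  Gamma (n%:R + beta) / (Gamma n%:R * Gamma (beta + 1)).

Definition asymp_equiv (R : realType) (a b : nat -> R) : Prop :=
  (a n / b n) @[n --> \oo] --> (1 : R).

Definition cond_prob (R : realType) (d : measure_display)
    (T : measurableType d) (P : probability T R) (A B : set T) : R :=
  fine (P (A `&` B)) / fine (P B).

Definition mutually_independent (R : realType) (d : measure_display)
    (T : measurableType d) (P : probability T R) (I : choiceType)
    (D : set I) (F : I -> set (set T)) : Prop :=
  forall (J : {fset I}) (A : I -> set T),
    [set` J] `<=` D -> (forall i, i \in J -> F i (A i)) ->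
    P (\bigcap_(i in [set` J]) A i) = (\prod_(i <- J) P (A i))%E.

(* [memory n] is beta_n and [coin n] decides whether the n-th step copies step
   beta_n; both are only used for n >= 2, and [X n] only for n >= 1. *)
Record elephant_walk (R : realType) (d : measure_display)
    (T : measurableType d) (P : probability T R) (p beta : R)
    (memory : nat -> {RV P >-> nat}) (coin : nat -> {RV P >-> bool})
    (X : nat -> {RV P >-> nat}) : Prop := {
  memory_law : forall n k : nat, (0 < n)%N ->
    P [set w | memory n.+1 w = k] =
    (if (1 <= k <= n)%N then (beta + 1) / n%:R * (mun beta k / mun beta n.+1)
     else 0)%:E ;
  coin_law : forall n : nat, (0 < n)%N ->
    P [set w | coin n.+1 w = true] = p%:E ;
  memory_coin_independent : mutually_independent P
    [set i : nat + nat | match i with inl n | inr n => (1 < n)%N end]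
    (fun i => match i with
              | inl n => preimage_set_system setT (memory n) measurable
              | inr n => preimage_set_system setT (coin n) measurable
              end) ;
  walk1 : forall w, X 1%N w = 1%N ;
  walkS : forall n : nat, (0 < n)%N ->
    {ae P, forall w,
      X n.+1 w = if coin n.+1 w then X (memory n.+1 w) w else 0%N}
}.

Section walk.
Context (R : realType) (T : Type).
Implicit Types (X : nat -> T -> nat) (w : T).

Definition Sn X (n : nat) w : nat := (\sum_(1 <= k < n.+1) X k w)%N.

Definition Sinfty X w : \bar R :=
  limn (fun n => ((Sn X n w)%:R : R)%:E).

Definition Sigman (beta : R) X (n : nat) w : R :=
  \sum_(1 <= k < n.+1) mun beta k * (X k w)%:R.

Definition Mn (p beta : R) X (n : nat) w : R :=
  Sigman beta X n w / cn (p * (beta + 1)) n.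

(* Where M_n w diverges, [limn] returns the default value 0; the limit exists
   almost surely. *)
Definition Minfty (p beta : R) X w : R :=
  limn (fun n => Mn p beta X n w).

Definition Cst (p beta : R) : R :=
  1 / (p * (beta + 1) - beta) * (Gamma (beta + 1) / Gamma (p * (beta + 1))).

End walk.

(* Main.v *)
Require Import Defs.
From HB Require Import structures.
From mathcomp Require Import all_boot all_order all_algebra.
From mathcomp Require Import all_classical all_reals all_analysis.
From mathcomp Require Import measurable_realfun finmap zify ring lra.

(** Why the theorem holds.

    Write alpha = p (beta + 1); the hypothesis on beta says 0 < beta < alpha.
    By independence of the choices the sequence of steps is a self-exciting
    chain of zeros and ones ([hist_step]): given the past up to time n, the
    next step is 1 with probability (alpha / n) Sigma_n / mu_{n+1}. Everything
    below uses only this chain and the recurrences of mu_n and c_n ([rising]).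

    M_n = Sigma_n / c_n is a martingale, and its later quadratic variation is
    controlled by a telescoping sum: with u_n = mu_n / c_n, which tends to 0,
    and kappa = alpha / (alpha - beta), the quantity
    (M_n - x)^2 + kappa u_n M_n is a supermartingale for every x
    ([superharmonic_energy]). Conditional expectations are replaced by
    superharmonic functions of the finite history, and the only probabilistic
    tool is Ville's inequality ([ville]): a nonnegative superharmonic function
    h reaches the level e with probability at most h(start) / e. It is applied
    to four functions.
    - An energy centred at M_n shows that M oscillates little after time n,
      hence converges almost surely ([ae_cvg_mart]).
    - Just after a step 1 one has M_n >= u_n, and an energy with a well-chosen
      centre bounds the probability of falling to M_n / 2 later by a constant
      theta < 1 ([ruin_le_theta]). From time 1 on, this gives
      P(S_oo = +oo) > 0 ([survival_gt0]).
    - A gambler who bets on such a fall again after each new step 1, multiplying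
      the stake by 1 / theta at each win, has a superharmonic capital. If there
      were infinitely many steps 1 and M tended to 0, all bets would be won and
      the capital would be unbounded; so this has probability 0 ([ae_escape]).
    The walk consisting of a single 1 has positive probability because the
    probabilities of leaving it, (alpha / beta) (1/mu_n - 1/mu_{n+1}), are
    summable, mu_n tending to infinity ([survival_lt1]).

    The asymptotics of S_n are then deterministic. Abel summation gives
    S_n = M_n r_n + (kappa - 1) sum_{1 <= k < n} M_k (r_{k+1} - r_k),
    where r_n = c_n / mu_n, so that S_n / r_n tends to kappa M_oo
    ([cvg_sum_of_weighted]); and r_n is equivalent to
    Gamma(beta + 1) / Gamma(alpha + 1) n^(alpha - beta) ([ratio_asymp]), by
    the elementary theory of Euler's integral developed first. *)

Set Implicit Arguments.
Unset Strict Implicit.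
Unset Printing Implicit Defensive.

Import Order.TTheory GRing.Theory Num.Theory.
Import numFieldTopology.Exports numFieldNormedType.Exports.

Local Open Scope classical_set_scope.
Local Open Scope ring_scope.

(** * Euler's integral *)

Section Gamma_function.
Context {R : realType}.
Implicit Types (x s t : R) (n : nat).
Local Notation mu := (@lebesgue_measure R).

Definition pos_axis : set R := `]0, +oo[.

Definition euler x t : R := t `^ (x - 1) * expR (- t).

Definition eGamma x : \bar R := \int[mu]_(t in pos_axis) (euler x t)%:E.

Lemma GammaE x : Gamma x = fine (eGamma x).
Proof. by []. Qed.

Lemma euler_ge0 x t : 0 <= euler x t.
Proof. by rewrite mulr_ge0 ?powR_ge0 ?expR_ge0. Qed.

Lemma continuous_euler x t : 0 < t -> {for t, continuous (euler x)}.
Proof.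
move=> t0; apply: continuousM.
  apply: differentiable_continuous; apply/derivable1_diffP.
  by apply: derivable_powR; rewrite in_itv/= t0.
apply: continuous_comp; first exact: continuousN.
exact: continuous_expR.
Qed.

Lemma measurable_euler x : measurable_fun pos_axis (euler x).
Proof.
apply: open_continuous_measurable_fun => // t.
by rewrite in_setE /pos_axis /= in_itv/= andbT; exact: continuous_euler.
Qed.

Lemma eGamma_ge0 x : (0 <= eGamma x)%E.
Proof. by apply: integral_ge0 => t _; rewrite lee_fin euler_ge0. Qed.

Lemma in_continuous_within (f : R -> R) (a b : R) :
  (forall t, t \in `[a, b] -> {for t, continuous f}) ->
  {within `[a, b], continuous f}.
Proof.
move=> cf; apply: continuous_in_subspaceT => t; rewrite in_setE => tab; exact: cf.
Qed.

Lemma is_derive_euler x t : 0 < t ->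
  is_derive t 1 (euler (x + 1)) (x * euler x t - euler (x + 1) t).
Proof.
move=> t0; rewrite /euler addrK.
pose D := @is_derive1_powR R x t t0.
apply: is_derive_eq.
by rewrite /GRing.scale/= ; ring.
Qed.

(** On a compact interval of positive numbers everything is continuous, so the
    functional equation holds up to boundary terms whatever the sign of
    [x - 1]. *)
Lemma euler_by_parts x (a b : R) : 0 < a -> a < b ->
  (\int[mu]_(t in `[a, b]) (x * euler x t)%:E =
   \int[mu]_(t in `[a, b]) (euler (x + 1) t)%:E
   + (euler (x + 1) b - euler (x + 1) a)%:E)%E.
Proof.
move=> a0 ab.
have pos t : t \in `[a, b] -> 0 < t.
  by rewrite in_itv/= => /andP[+ _]; exact: lt_le_trans.
have c1 y : {within `[a, b], continuous (euler y)}.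
  by apply: in_continuous_within => t /pos t0; exact: continuous_euler.
have i1 y : mu.-integrable `[a, b] (EFin \o euler y).
  by apply: continuous_compact_integrable => //; exact: segment_compact.
have c2 : {within `[a, b], continuous (fun t => x * euler x t - euler (x + 1) t)}.
  apply: in_continuous_within => t /pos t0; apply: continuousB.
    by apply: continuousM; [exact: cst_continuous|exact: continuous_euler].
  exact: continuous_euler.
have i2 : mu.-integrable `[a, b] (EFin \o (fun t => x * euler x t - euler (x + 1) t)).
  by apply: continuous_compact_integrable => //; exact: segment_compact.
have FTC : (\int[mu]_(t in `[a, b]) (x * euler x t - euler (x + 1) t)%:E =
   (euler (x + 1) b)%:E - (euler (x + 1) a)%:E)%E.
  apply: continuous_FTC2 => //.
    have cF t : 0 < t -> euler (x + 1) y @[y --> t] --> euler (x + 1) t.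
      by move=> t0; exact: continuous_euler.
    split.
    + move=> t tab; have t0 : 0 < t by apply: pos; exact: subset_itv_oo_cc tab.
      by have [] := is_derive_euler x t0.
    + apply: cvg_at_right_filter; exact: cF.
    + by apply: cvg_at_left_filter; apply: cF; exact: lt_trans ab.
  move=> t tab; have t0 : 0 < t by apply: pos; exact: subset_itv_oo_cc tab.
  by rewrite derive1E; have D := is_derive_euler x t0; rewrite derive_val.
rewrite EFinB -FTC -integralD//=; last exact: i1.
by apply: eq_integral => t _; rewrite -EFinD addrC subrK.
Qed.

Lemma euler_cvg0_right x : 0 < x -> euler (x + 1) n.+1%:R^-1 @[n --> \oo] --> (0:R).
Proof.
move=> x0; rewrite /euler addrK.
have c0 : (n.+1%:R^-1 : R) `^ x @[n --> \oo] --> (0:R).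
  have /cvg_at_rightP := powR_cvg0 x0.
  by apply; split=> [n|]; [rewrite invr_gt0 ltr0n|exact: cvg_harmonic].
apply: (@squeeze_cvgr _ _ _ _ (cst 0) (fun n => (n.+1%:R^-1 : R) `^ x)) => //.
- near=> n; rewrite mulr_ge0 ?powR_ge0 ?expR_ge0//=.
  by rewrite ler_piMr ?powR_ge0// expR_le1 oppr_le0.
- exact: cvg_cst.
Unshelve. all: by end_near. Qed.

Lemma euler_cvg0_pinfty x : euler (x + 1) n.+1%:R @[n --> \oo] --> (0:R).
Proof.
rewrite /euler addrK.
have [k xk] : exists k : nat, x <= k%:R.
  by exists (Num.trunc x).+1; rewrite ltW// truncnS_gt.
apply: (@squeeze_cvgr _ _ _ _ (cst 0) (fun n => (k.+1)`!%:R * n.+1%:R^-1 : R)).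
- near=> n; rewrite mulr_ge0 ?powR_ge0 ?expR_ge0//=.
  rewrite expRN ler_pdivrMr ?expR_gt0// mulrAC ler_pdivlMr ?ltr0n//.
  apply: (@le_trans _ _ (n.+1%:R ^+ k.+1)).
    rewrite exprSr ler_wpM2r ?ler0n// -powR_mulrn ?ler0n// ler_powR//.
    by rewrite ler1n.
  rewrite mulrC -ler_pdivrMr ?ltr0n ?fact_gt0//.
  by apply: le_trans (expR_ge1Dxn k _) => //; rewrite lerDr.
- exact: cvg_cst.
- by rewrite -(mulr0 (k.+1)`!%:R); apply: cvgMr; exact: cvg_harmonic.
Unshelve. all: by end_near. Qed.

(** The intervals [1/(n+2), n+2] exhaust the half-line, the boundary terms of
    [euler_by_parts] vanish in the limit and both integrals converge
    monotonically. Integrability is not known at this point, hence the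
    extended real values. *)
Lemma eGammaS x : 0 < x -> eGamma (x + 1) = (x%:E * eGamma x)%E.
Proof.
move=> x0.
pose F n : set R := `[n.+2%:R^-1, n.+2%:R]%classic.
have FE : \bigcup_n F n = pos_axis.
  apply/seteqP; split=> t.
    move=> [n _]; rewrite /F /pos_axis/= !in_itv/= andbT => /andP[+ _].
    by apply: lt_le_trans; rewrite invr_gt0.
  rewrite /F /pos_axis/= in_itv/= andbT => t0.
  exists (Num.trunc t + Num.trunc t^-1)%N => //=; rewrite in_itv/=; apply/andP; split.
    rewrite -[leRHS]invrK lef_pV2 ?posrE ?invr_gt0// ltW//.
    apply: lt_le_trans (truncnS_gt _) _.
    by rewrite ler_nat ltnS leqW// leq_addl.
  apply: ltW; apply: lt_le_trans (truncnS_gt _) _.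
  by rewrite ler_nat ltnS leqW// leq_addr.
have mF n : measurable (F n) by exact: measurable_itv.
have ndF : nondecreasing_seq F.
  move=> m n mn; apply/subsetPset => t; rewrite /F/= !in_itv/= => /andP[t1 t2].
  apply/andP; split; last by apply: le_trans t2 _; rewrite ler_nat; lia.
  by apply: le_trans t1; rewrite lef_pV2 ?posrE// ler_nat; lia.
have cvgG y (c : R) : 0 <= c -> (\int[mu]_(t in F n) (c * euler y t)%:E @[n --> \oo] -->
    c%:E * eGamma y)%E.
  move=> c0; rewrite /eGamma -ge0_integralZl//; last 3 first.
  - exact: measurable_itv.
  - by apply/measurable_EFinP; exact: measurable_euler.
  - by move=> t _; rewrite lee_fin euler_ge0.
  under [X in (_ --> X)%E]eq_integral do rewrite -EFinM.
  rewrite -FE; apply: ge0_nondecreasing_set_cvg_integral => //.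
  - move=> n; apply/measurable_EFinP; apply: measurable_funM => //.
    by apply: measurable_funS (@measurable_euler y); [exact: measurable_itv|rewrite -FE; exact: bigcup_sup].
  - by move=> n t _; rewrite lee_fin mulr_ge0 ?euler_ge0.
have c1 := cvgG x x (ltW x0).
have c2 := cvgG (x + 1) 1 ler01.
have c3 : (euler (x + 1) n.+2%:R - euler (x + 1) n.+2%:R^-1)%:E @[n --> \oo] --> 0%:E.
  apply: cvg_EFin; first by apply: nearW.
  rewrite /comp/= -(subr0 (0:R)); apply: cvgB.
    have := @euler_cvg0_pinfty x; rewrite -cvg_shiftS; exact.
  have := euler_cvg0_right x0; rewrite -cvg_shiftS; exact.
rewrite mul1e in c2.
have {c2 c3} c4 : (\int[mu]_(t in F n) (1 * euler (x + 1) t)%:E +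
    (euler (x + 1) n.+2%:R - euler (x + 1) n.+2%:R^-1)%:E)%E @[n --> \oo] -->
    (eGamma (x + 1) + 0%:E)%E.
  by apply: cvgeD c2 c3; rewrite fin_num_adde_defl.
have AB : (fun n => \int[mu]_(t in F n) (x * euler x t)%:E)%E =
    (fun n => \int[mu]_(t in F n) (1 * euler (x + 1) t)%:E +
    (euler (x + 1) n.+2%:R - euler (x + 1) n.+2%:R^-1)%:E)%E.
  apply/funext => n; rewrite /F euler_by_parts.
  - by congr (_ + _)%E; apply: eq_integral => t _; rewrite mul1r.
  - by rewrite invr_gt0.
  - by rewrite (@lt_trans _ _ 1)// ?invf_lt1 ?ltr1n.
rewrite AB in c1.
have := cvg_lim (@ereal_hausdorff R) c1.
by rewrite (cvg_lim (@ereal_hausdorff R) c4) adde0; apply.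
Qed.

Lemma eGamma1 : eGamma 1 = 1%E.
Proof.
rewrite -(@integral_exponential_pdf R 1 ltr01).
rewrite [RHS](_ : _ = \int[mu]_(t in `[0%R, +oo[) (expR (- t))%:E)%E; last first.
  rewrite [RHS]integral_mkcond; apply: eq_integral => t _.
  rewrite /exponential_pdf !patchE; case: ifPn => // _.
  by rewrite mul1r mulN1r.
rewrite -integral_itv_obnd_cbnd; last first.
  apply: measurable_funTS; apply/measurable_EFinP.
  by apply: measurableT_comp => //; exact: measurable_oppr.
by apply: eq_integral => t _; rewrite /euler subrr powRr0 mul1r.
Qed.

(** Convexity of the exponential, between the exponents 0 and 1. *)
Lemma powR_le_line (t s : R) : 0 <= t -> 0 <= s <= 1 -> t `^ s <= 1 - s + s * t.
Proof.
rewrite le_eqVlt => /predU1P[<-|t0] /andP[s0 s1].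
  rewrite mulr0 addr0; have [->|sn0] := eqVneq s 0; first by rewrite powRr0 subr0.
  by rewrite powR0// subr_ge0.
rewrite /powR gt_eqF//.
have := @convex_expR R (Itv01 s0 s1) (ln t : R^o) (0 : R^o).
by rewrite !convRE/= mulr0 addr0 expR0 lnK ?posrE// mulr1 addrC.
Qed.

(** [powR_le_line] dominates the integral at 1 + s by those at 1 and 2, which
    are both 1; the functional equation reaches all other arguments. *)
Lemma eGamma_lty x : 0 < x -> (eGamma x < +oo)%E.
Proof.
have base s : 0 <= s <= 1 -> (eGamma (1 + s) < +oo)%E.
  move=> /andP[s0 s1].
  apply: (@le_lt_trans _ _ (eGamma 1 + eGamma (1 + 1))%E).
    have mpos : measurable pos_axis by exact: measurable_itv.
    have mE y : measurable_fun pos_axis (fun t => (euler y t)%:E).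
      by apply/measurable_EFinP; exact: measurable_euler.
    have E0 y t : pos_axis t -> (0 <= (euler y t)%:E)%E by rewrite lee_fin euler_ge0.
    rewrite /eGamma -ge0_integralD//; try exact: E0; try exact: mE.
    apply: ge0_le_integral => //; [exact: E0|exact: mE| |].
      exact: emeasurable_funD (mE _) (mE _).
    move=> t; rewrite /pos_axis/= in_itv/= andbT => /ltW t0.
    rewrite -EFinD lee_fin /euler -mulrDl ler_wpM2r ?expR_ge0//.
    rewrite subrr powRr0 addrAC subrr add0r (addrC 1 1) addrK powRr1//.
    apply: le_trans (powR_le_line t0 _) _; first by rewrite s0.
    have : s * t <= t by rewrite ler_piMl.
    by move: s0; lra.
  by rewrite eGammaS// !eGamma1 mule1 -EFinD ltry.
have nat_shift n s : 0 <= s <= 1 -> (eGamma (n.+1%:R + s) < +oo)%E.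
  move=> s01; elim: n => [|n IH]; first exact: base.
  have p0 : 0 < n.+1%:R + s :> R by case/andP: s01 => s0 _; rewrite ltr_wpDr.
  rewrite -[n.+2%:R]natr1 addrAC eGammaS//.
  by rewrite lte_mul_pinfty// lee_fin ltW.
move=> x0.
have : (eGamma (x + 1) < +oo)%E.
  have -> : x + 1 = (Num.trunc x).+1%:R + (x - (Num.trunc x)%:R).
    by rewrite -natr1; ring.
  have /andP[tx xt] := truncn_itv (ltW x0).
  by apply: nat_shift; rewrite subr_ge0 tx lerBlDr addrC natr1 ltW.
rewrite eGammaS//.
have := eGamma_ge0 x; case: (eGamma x) => [r _ _|_|]//; first exact: ltry.
by rewrite gt0_muley ?lte_fin.
Qed.

Lemma eGamma_fin x : 0 < x -> eGamma x \is a fin_num.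
Proof. by move=> x0; rewrite ge0_fin_numE ?eGamma_ge0 ?eGamma_lty. Qed.

Lemma euler_integrable x : 0 < x -> mu.-integrable pos_axis (EFin \o euler x).
Proof.
move=> x0; apply/integrableP; split.
  by apply/measurable_EFinP; exact: measurable_euler.
suff -> : (\int[mu]_(t in pos_axis) `|(EFin \o euler x) t| = eGamma x)%E.
  exact: eGamma_lty.
by apply: eq_integral => t _ /=; rewrite ger0_norm// euler_ge0.
Qed.

Lemma GammaS x : 0 < x -> Gamma (x + 1) = x * Gamma x.
Proof. by move=> x0; rewrite !GammaE eGammaS// fineM// eGamma_fin. Qed.

Lemma Gamma1 : Gamma (1 : R) = 1.
Proof. by rewrite GammaE eGamma1. Qed.

Lemma Gamma_nat n : Gamma (n.+1%:R : R) = n`!%:R.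
Proof.
elim: n => [|n IH]; first by rewrite Gamma1.
by rewrite -[n.+2%:R]natr1 GammaS// IH -natrM factS.
Qed.

(** [powR_le_line] at t / x, integrated against t^(x-1) e^(-t): the line is
    chosen so that the right-hand side involves only Gamma x and
    Gamma (x + 1) = x Gamma x. *)
Lemma Gamma_shift_le x s : 0 < x -> 0 <= s <= 1 ->
  Gamma (x + s) <= x `^ s * Gamma x.
Proof.
move=> x0 s01; have [s0 s1] := andP s01.
have xs0 : 0 < x + s by rewrite ltr_wpDr.
have x10 : 0 < x + 1 by rewrite addr_gt0.
have c0 : 0 <= x `^ s by exact: powR_ge0.
have -> : x `^ s * Gamma x = x `^ s * (1 - s) * Gamma x + x `^ s * (s / x) * Gamma (x + 1).
  rewrite GammaS//; field; exact: lt0r_neq0.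
rewrite /Gamma.
have iZ (k y : R) : 0 < y -> mu.-integrable pos_axis (EFin \o (fun t => k * euler y t)).
  move=> y0; rewrite (_ : _ \o _ = fun t => k%:E * (euler y t)%:E)%E; last exact/funext.
  by apply: integrableZl; [exact: measurable_itv|exact: euler_integrable].
rewrite -RintegralZl//; last exact: euler_integrable.
rewrite -RintegralZl//; last exact: euler_integrable.
rewrite -RintegralD//; [|exact: iZ..].
apply: le_Rintegral => //; first exact: euler_integrable.
  set f := fun t => x `^ s * (1 - s) * euler x t.
  set g := fun t => x `^ s * (s / x) * euler (x + 1) t.
  rewrite (_ : _ \o _ = (fun t => (EFin \o f) t + (EFin \o g) t)%E); last exact/funext.
  by apply: integrableD => //; exact: iZ.
move=> t; rewrite /= in_itv/= andbT => t0.
have -> : t `^ (x + s - 1) = t `^ (x - 1) * t `^ s.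
  by rewrite -powRD ?(gt_eqF t0) ?implybT// addrAC.
have -> : t `^ (x + 1 - 1) = t `^ (x - 1) * t.
  by rewrite addrK mulrC mulr_powRB1// ltW.
have -> : t `^ s = x `^ s * (t / x) `^ s.
  by rewrite -powRM ?divr_ge0 ?ltW// mulrC divfK// lt0r_neq0.
have := powR_le_line (divr_ge0 (ltW t0) (ltW x0)) s01.
set A := t `^ _; set B := expR _; set C := x `^ s; set D := _ `^ s.
have A0 : 0 <= A by exact: powR_ge0.
have B0 : 0 <= B by exact: expR_ge0.
move=> /(ler_wpM2l (mulr_ge0 (mulr_ge0 A0 B0) c0)); rewrite -/C.
have -> : A * B * C * D = A * (C * D) * B by ring.
by move=> /le_trans; apply; rewrite le_eqVlt; apply/orP; left; apply/eqP; ring.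
Qed.

(** [Gamma_shift_le] bounds a factorial by a multiple of Gamma x. *)
Lemma Gamma_gt0 x : 0 < x -> 0 < Gamma x.
Proof.
move=> x0.
have /andP[n1 n2] := truncn_itv (ltW x0).
have := @Gamma_shift_le x ((Num.trunc x).+1%:R - x) x0.
rewrite subrKC Gamma_nat => H.
have : 0 < x `^ ((Num.trunc x).+1%:R - x) * Gamma x.
  apply: lt_le_trans (H _); first by rewrite ltr0n fact_gt0.
  by rewrite subr_ge0 (ltW n2)/= lerBlDr -natr1 addrC lerD2l.
by rewrite pmulr_rgt0// powR_gt0.
Qed.

(** [Gamma_shift_le] from x + s to x + 1. *)
Lemma Gamma_shift_ge x s : 0 < x -> 0 <= s <= 1 ->
  x * Gamma x <= (x + s) `^ (1 - s) * Gamma (x + s).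
Proof.
move=> x0 /andP[s0 s1].
have xs0 : 0 < x + s by rewrite ltr_wpDr.
rewrite -GammaS//; have -> : x + 1 = x + s + (1 - s) by ring.
by apply: Gamma_shift_le => //; rewrite subr_ge0 s1 lerBlDr lerDl.
Qed.

End Gamma_function.

(** * Real sequences and ratios of Gamma functions *)

Section real_sequences.
Context {R : realType}.
Implicit Types (u : nat -> R) (e : R).

Lemma ltr_inv_nat e : 0 < e -> exists j : nat, j.+1%:R^-1 < e.
Proof.
move=> e0; exists (Num.trunc e^-1).
rewrite -[ltRHS]invrK ltf_pV2 ?posrE ?invr_gt0//.
exact: truncnS_gt.
Qed.

(** Convergence as countably many conditions on the terms, which makes the event
    that a sequence of random variables converges measurable; likewise for
    [cvgn_cauchyP]. *)
Lemma cvgn0P u : u n @[n --> \oo] --> 0 <->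
  forall j : nat, exists N, forall n, (N <= n)%N -> `|u n| < j.+1%:R^-1.
Proof.
split=> [u0 j|H].
  have j0 : (0 : R) < j.+1%:R^-1 by rewrite invr_gt0.
  have /cvgr0Pnorm_lt /(_ _ j0) [N _ HN] := u0.
  by exists N => n; exact: HN.
apply/cvgr0Pnorm_lt => e /ltr_inv_nat[j je].
have [N HN] := H j; exists N => // n /HN /lt_trans; exact.
Qed.

Lemma cvgn_cauchyP u : cvgn u <->
  forall j : nat, exists N, forall n, (N <= n)%N -> `|u n - u N| < j.+1%:R^-1.
Proof.
split=> [/cvg_ex[l ul] j|H].
  have j0 : (0 : R) < j.+1%:R^-1 / 2 by rewrite divr_gt0// invr_gt0.
  have /cvgrPdist_lt /(_ _ j0) [N _ HN] := ul.
  exists N => n Nn; have h1 := HN _ Nn; have h2 := HN _ (leqnn N).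
  have -> : u n - u N = (l - u N) - (l - u n) by ring.
  by apply: le_lt_trans (ler_normB _ _) _; rewrite [ltRHS]splitr ltrD.
apply: cauchy_cvg; apply: cauchy_exP => e /ltr_inv_nat[j je].
have [N HN] := H j; exists (u N); exists N => // n /= Nn.
by rewrite /ball /= distrC; apply: lt_trans je; exact: HN.
Qed.

End real_sequences.

Section Gamma_ratio.
Context {R : realType}.
Implicit Types (g s : R) (n : nat).

Lemma eq_pos_cvg (u v : nat -> R) (l : set_system R) :
  (forall n, (0 < n)%N -> u n = v n) -> v n @[n --> \oo] --> l -> u n @[n --> \oo] --> l.
Proof.
move=> uv; apply: cvg_trans; apply: near_eq_cvg; near=> n; rewrite uv//.
near: n; exact: nbhs_infty_gt.
Unshelve. all: by end_near. Qed.

Lemma cvg_addn_ratio g : (n%:R + g) / n%:R @[n --> \oo] --> (1 : R).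
Proof.
have cI : (n%:R^-1 : R) @[n --> \oo] --> (0 : R).
  by rewrite -cvg_shiftS; exact: cvg_harmonic.
rewrite -[X in _ --> X]addr0 -(mulr0 g).
apply: (@eq_pos_cvg _ (fun n => 1 + g * n%:R^-1)).
  by move=> n n0; rewrite mulrDl divff// pnatr_eq0 -lt0n.
by apply: cvgD; [exact: cvg_cst|exact: cvgMr].
Qed.

(** For exponents in [0, 1] the two shift inequalities squeeze the ratio; the
    functional equation then raises the exponent by one. *)
Lemma Gamma_ratio_cvg g : 0 <= g ->
  Gamma (n%:R + g) / (Gamma n%:R * n%:R `^ g) @[n --> \oo] --> (1 : R).
Proof.
move=> g0.
have [k [s [s01 ->]]] : exists k : nat, exists s, 0 <= s <= 1 /\ g = s + k%:R.
  have /andP[tg gt] := truncn_itv g0.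
  exists (Num.trunc g), (g - (Num.trunc g)%:R); rewrite subrK; split=> //.
  by rewrite subr_ge0 tg lerBlDr addrC natr1 ltW.
elim: k => [|k IH].
  rewrite addr0; have [s0 s1] := andP s01.
  apply: (@squeeze_cvgr _ _ _ _ (fun n => ((n%:R + s) / n%:R)^-1) (cst 1)).
  - near=> n.
    have n0 : (0 : R) < n%:R by rewrite ltr0n; near: n; exact: nbhs_infty_gt.
    have ns0 : 0 < n%:R + s by rewrite ltr_wpDr.
    have G0 : 0 < Gamma (n%:R : R) by exact: Gamma_gt0.
    have Gs0 : 0 < Gamma (n%:R + s) by exact: Gamma_gt0.
    have p0 : 0 < n%:R `^ s :> R by exact: powR_gt0.
    apply/andP; split; last first.
      rewrite /= ler_pdivrMr ?mulr_gt0// mul1r [leRHS]mulrC.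
      exact: Gamma_shift_le.
    rewrite invf_div ler_pdivrMr// mulrAC ler_pdivlMr ?mulr_gt0//.
    apply: (@le_trans _ _ (n%:R `^ s * ((n%:R + s) `^ (1 - s) * Gamma (n%:R + s)))).
      rewrite [leLHS]mulrA [leLHS]mulrC; apply: ler_wpM2l; [exact: ltW|exact: Gamma_shift_ge].
    rewrite [leLHS]mulrA [leRHS]mulrC ler_wpM2r ?(ltW Gs0)//.
    apply: (@le_trans _ _ ((n%:R + s) `^ s * (n%:R + s) `^ (1 - s))).
      by rewrite ler_wpM2r ?powR_ge0// ge0_ler_powR ?nnegrE ?(ltW n0) ?(ltW ns0)// lerDl.
    by rewrite -powRD ?(gt_eqF ns0) ?implybT// subrKC powRr1// ltW.
  - rewrite -[X in _ --> X]invr1; apply: cvgV => //; exact: cvg_addn_ratio.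
  - exact: cvg_cst.
rewrite -[X in _ --> X]mulr1.
apply: (eq_pos_cvg _ (cvgM IH (cvg_addn_ratio (s + k%:R)))) => n n_gt0.
have n0 : (0 : R) < n%:R by rewrite ltr0n.
have sk0 : 0 <= s + k%:R by case/andP: s01 => ? _; rewrite addr_ge0.
have -> : n%:R + (s + k.+1%:R) = n%:R + (s + k%:R) + 1 by rewrite -natr1; ring.
have -> : n%:R `^ (s + k.+1%:R) = n%:R `^ (s + k%:R) * n%:R.
  by rewrite -natr1 addrA (@powRD _ _ (s + k%:R) 1) ?(gt_eqF n0) ?implybT// powRr1 ?ltW.
rewrite GammaS ?ltr_wpDr//.
have G0 : Gamma (n%:R : R) != 0 by rewrite gt_eqF// Gamma_gt0.
have p0 : n%:R `^ (s + k%:R) != 0 :> R by rewrite gt_eqF// powR_gt0.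
have n0' : n%:R != 0 :> R by rewrite gt_eqF.
by rewrite /=; field; rewrite n0' p0 G0.
Unshelve. all: by end_near. Qed.

Lemma mun_gt0 g n : 0 < g -> (0 < n)%N -> 0 < mun g n.
Proof.
move=> g0 n0; have n0' : (0 : R) < n%:R by rewrite ltr0n.
by rewrite /mun divr_gt0 ?mulr_gt0// Gamma_gt0// addr_gt0.
Qed.

Lemma mun1 g : 0 < g -> mun g 1 = 1.
Proof.
move=> g0; rewrite /mun Gamma1 mul1r addrC divff// gt_eqF// Gamma_gt0//.
by rewrite addr_gt0.
Qed.

Lemma munS g n : 0 < g -> (0 < n)%N -> mun g n.+1 = mun g n * ((n%:R + g) / n%:R).
Proof.
move=> g0 n0; have n0' : (0 : R) < n%:R by rewrite ltr0n.
rewrite /mun -natr1 addrAC !GammaS ?addr_gt0//.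
have G0 : Gamma (n%:R : R) != 0 by rewrite gt_eqF// Gamma_gt0.
have G1 : Gamma (g : R) != 0 by rewrite gt_eqF// Gamma_gt0.
by field; rewrite !gt_eqF// Gamma_gt0.
Qed.

(** The recurrence characterising [mun g] and [cn g]. The study of the walk
    uses the weights only through it, so that no Gamma function appears
    there. *)
Definition rising g (w : nat -> R) : Prop :=
  w 1%N = 1 /\ forall n, (0 < n)%N -> w n.+1 = w n * ((n%:R + g) / n%:R).

Lemma rising_gt0 g w n : 0 < g -> rising g w -> (0 < n)%N -> 0 < w n.
Proof.
move=> g0 [w1 wS]; elim: n => // -[|n] IH _; first by rewrite w1.
have n0 : 0 < n.+1%:R :> R by rewrite ltr0n.
by rewrite wS// mulr_gt0 ?IH// divr_gt0// addr_gt0.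
Qed.

Lemma rising_mun g : 0 < g -> rising g (mun g).
Proof. by move=> g0; split; [exact: mun1|move=> n; exact: munS]. Qed.

Lemma mun_asymp g : 0 < g ->
  mun g n / n%:R `^ g @[n --> \oo] --> (Gamma (g + 1))^-1.
Proof.
move=> g0; rewrite -[X in _ --> X]mul1r.
apply: (eq_pos_cvg _ (cvgM (Gamma_ratio_cvg (ltW g0)) (cvg_cst _))) => n _.
by rewrite /mun /= !invfM; ring.
Qed.

Lemma powR_cvg_pinfty g : 0 < g -> (n%:R `^ g : R) @[n --> \oo] --> +oo.
Proof.
move=> g0; apply/cvgryPge => A.
near=> n.
have A0 : 0 <= `|A| by [].
apply: le_trans (ler_norm A) _.
have -> : `|A| = (`|A| `^ g^-1) `^ g by rewrite -powRrM mulVf ?gt_eqF// powRr1.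
rewrite ge0_ler_powR ?nnegrE ?powR_ge0 ?ler0n ?(ltW g0)//.
near: n; exact: nbhs_infty_ger.
Unshelve. all: by end_near. Qed.

Lemma mun_cvg_pinfty g : 0 < g -> mun g n @[n --> \oo] --> +oo.
Proof.
move=> g0; have G0 : 0 < (Gamma (g + 1))^-1 by rewrite invr_gt0 Gamma_gt0// addr_gt0.
have c := mun_asymp g0.
apply: (@eq_pos_cvg _ (fun n => n%:R `^ g * (mun g n / n%:R `^ g))).
  by move=> n n0; rewrite mulrC divfK// gt_eqF// powR_gt0// ltr0n.
apply/cvgryPge => A; near=> n.
apply: (@le_trans _ _ (n%:R `^ g * ((Gamma (g + 1))^-1 / 2))).
  rewrite -ler_pdivrMr ?divr_gt0//; near: n.
  exact: (cvgryPge _).1 (powR_cvg_pinfty g0) _.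
rewrite ler_wpM2l ?powR_ge0// ltW//; near: n.
by apply: (cvgr_gt _ c); rewrite ltr_pdivrMr// ltr_pMr// ltr1n.
Unshelve. all: by end_near. Qed.

End Gamma_ratio.

(** * The chain of histories and its superharmonic functions *)

Definition alpha {R : realType} (p beta : R) : R := p * (beta + 1).

(** Both the factor between the sums of the steps and the normalised weighted
    sums, and the constant of the second-moment bound [superharmonic_energy]. *)
Definition kappa {R : realType} (p beta : R) : R :=
  alpha p beta / (alpha p beta - beta).

Section chain.
Context {R : realType} (p beta : R) (mu c : nat -> R).
Hypotheses (p01 : 0 < p < 1) (b01 : 0 < beta < p / (1 - p)).
Local Notation alpha := (alpha p beta).
Local Notation kappa := (kappa p beta).
Hypotheses (Hmu : rising beta mu) (Hc : rising alpha c).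
Implicit Types (v : seq bool) (f : seq bool -> R) (x : R).

Lemma p_gt0 : 0 < p. Proof. by case/andP: p01. Qed.
Lemma p_lt1 : p < 1. Proof. by case/andP: p01. Qed.
Lemma beta_gt0 : 0 < beta. Proof. by case/andP: b01. Qed.

Lemma beta_lt_alpha : beta < alpha.
Proof.
have q0 : 0 < 1 - p by rewrite subr_gt0 p_lt1.
have := b01; rewrite ltr_pdivlMr// /alpha => /andP[_]; lra.
Qed.

Lemma alpha_gt0 : 0 < alpha.
Proof. exact: lt_trans beta_gt0 beta_lt_alpha. Qed.

Lemma kappa_gt0 : 0 < kappa.
Proof. by rewrite divr_gt0 ?alpha_gt0// subr_gt0 beta_lt_alpha. Qed.

(** A history lists the steps of the walk from the last one to the first, so
    that one more step is one more [cons]. *)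
Fixpoint wsum v : R :=
  if v is b :: v' then wsum v' + mu (size v) * b%:R else 0.

Definition mart v : R := wsum v / c (size v).

(** The conditional probability, given the history [v], that the next step is
    1. *)
Definition pstep v : R := alpha / (size v)%:R * (wsum v / mu (size v).+1).

(** Conditional expectation of [f] at the next history. *)
Definition transition f v : R :=
  pstep v * f (true :: v) + (1 - pstep v) * f (false :: v).

Definition superharmonic f := forall v, (0 < size v)%N -> transition f v <= f v.

Definition scale n : R := mu n / c n.

Lemma mu_gt0 n : (0 < n)%N -> 0 < mu n.
Proof. exact: rising_gt0 beta_gt0 Hmu. Qed.

Lemma c_gt0 n : (0 < n)%N -> 0 < c n.
Proof. exact: rising_gt0 alpha_gt0 Hc. Qed.

Lemma scale_gt0 n : (0 < n)%N -> 0 < scale n.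
Proof. by move=> n0; rewrite divr_gt0 ?mu_gt0 ?c_gt0. Qed.

Lemma wsum_ge0 v : 0 <= wsum v.
Proof.
elim: v => //= b v IH; apply: addr_ge0 => //; apply: mulr_ge0; last exact: ler0n.
by apply: ltW; apply: mu_gt0.
Qed.

(** With equality when all steps are 1, which expresses that the law of the
    memory has total mass 1. *)
Lemma wsum_le v : (beta + 1) * wsum v <= (size v)%:R * mu (size v).+1.
Proof.
elim: v => [|b v IH] /=; first by rewrite mulr0 mul0r.
have b0 := beta_gt0; have m0 : 0 < mu (size v).+1 by rewrite mu_gt0.
have b1 : (b%:R : R) <= 1 by case: b; rewrite ?ler01.
have -> : (size v).+1%:R * mu (size v).+2 = ((size v).+1%:R + beta) * mu (size v).+1.
  by rewrite Hmu.2// mulrCA (mulrCA _%:R) divff ?pnatr_eq0// mulr1 mulrC.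
rewrite mulrDr.
apply: (@le_trans _ _ ((size v)%:R * mu (size v).+1 + (beta + 1) * mu (size v).+1)).
  by rewrite lerD// ler_wpM2l ?addr_ge0 ?(ltW b0)// ler_piMr// ltW.
by rewrite -natr1; lra.
Qed.

Lemma mart_ge0 v : (0 < size v)%N -> 0 <= mart v.
Proof. by move=> v0; rewrite divr_ge0 ?wsum_ge0 ?(ltW (c_gt0 _)). Qed.

Lemma pstep_ge0 v : 0 <= pstep v.
Proof.
by rewrite mulr_ge0// divr_ge0 ?wsum_ge0 ?ler0n ?(ltW alpha_gt0)// ltW// mu_gt0.
Qed.

Lemma pstep_le v : pstep v <= p.
Proof.
have [v0|] := posnP (size v).
  by rewrite /pstep v0 invr0 mulr0 mul0r ltW// p_gt0.
rewrite -(ltr0n R) => v0.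
rewrite /pstep /alpha mulrACA -invfM ler_pdivrMr ?mulr_gt0 ?mu_gt0//.
by rewrite -mulrA ler_wpM2l ?(ltW p_gt0)// wsum_le.
Qed.

Lemma pstep_le1 v : pstep v <= 1.
Proof. exact: le_trans (pstep_le v) (ltW p_lt1). Qed.

Lemma transition_le f g v : f (true :: v) <= g (true :: v) ->
  f (false :: v) <= g (false :: v) -> transition f v <= transition g v.
Proof.
move=> ft ff; rewrite lerD// ler_wpM2l ?pstep_ge0//.
by rewrite subr_ge0 pstep_le1.
Qed.

Lemma transition_cst x v : transition (fun=> x) v = x.
Proof. by rewrite /transition; ring. Qed.

(** The weight of a step equal to 1 alone is worth [scale]; this is what makes
    the second moment after such a step comparable with the squared mean. *)
Lemma mart_cons_ge v : scale (size v).+1 <= mart (true :: v).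
Proof.
by rewrite /mart/= mulr1 ler_wpM2r ?lerDr ?wsum_ge0// invr_ge0 ltW// c_gt0.
Qed.

Lemma transition_mart v : (0 < size v)%N -> transition mart v = mart v.
Proof.
move=> v0; have v0' : 0 < (size v)%:R :> R by rewrite ltr0n.
have c0 := c_gt0 v0; have m0 := mu_gt0 v0; have b0 := beta_gt0; have a0 := alpha_gt0.
rewrite /transition /mart /pstep /= !(Hmu.2, Hc.2)//.
field.
by rewrite !gt_eqF ?addr_gt0.
Qed.

(** Squared distance to [x] of the martingale plus a bound for the variance it
    still has to pick up. The latter is affine in the martingale because the
    steps are 0 or 1. *)
Definition energy x v : R := (mart v - x) ^+ 2 + kappa * scale (size v) * mart v.

(** The increments of the variance telescope: [scale n - scale n.+1] is
    [scale n.+1 * (alpha - beta) / (n + beta)], so [kappa * scale] dominates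
    the sum of all later increments. The difference of the two sides is an
    explicit sum of nonnegative terms. *)
Lemma superharmonic_energy x : superharmonic (energy x).
Proof.
move=> v v0; have v0' : 0 < (size v)%:R :> R by rewrite ltr0n.
have c0 := c_gt0 v0; have m0 := mu_gt0 v0; have b0 := beta_gt0; have a0 := alpha_gt0.
have w0 := wsum_ge0 v.
have ab0 : 0 < alpha - beta by rewrite subr_gt0 beta_lt_alpha.
rewrite -subr_ge0.
have -> : energy x v - transition (energy x) v =
  (wsum v * alpha / ((size v)%:R + alpha) / c (size v)) ^+ 2 +
  alpha * wsum v * mu (size v) * (alpha - beta) / (((size v)%:R + alpha) ^+ 2 * c (size v) ^+ 2).
  rewrite /transition /energy /mart /scale /pstep /= !(Hmu.2, Hc.2)// /kappa.
  field.
  by rewrite (gt_eqF ab0) !gt_eqF ?addr_gt0.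
apply: addr_ge0; first exact: sqr_ge0.
apply: divr_ge0; last by apply: mulr_ge0; exact: sqr_ge0.
apply: mulr_ge0; last exact: ltW.
by apply: mulr_ge0; [apply: mulr_ge0 => //; exact: ltW|exact: ltW].
Qed.

Lemma transitionZ f x v : transition (fun v => x * f v) v = x * transition f v.
Proof. by rewrite /transition; ring. Qed.

Lemma energy_ge0 x v : (0 < size v)%N -> 0 <= energy x v.
Proof.
move=> v0; apply: addr_ge0; first exact: sqr_ge0.
apply: mulr_ge0; last exact: mart_ge0 v0.
by apply: mulr_ge0; apply: ltW; [exact: kappa_gt0|exact: scale_gt0 v0].
Qed.

Lemma energy_ge x (e : R) v : 0 <= e -> (0 < size v)%N -> e <= `|mart v - x| ->
  e ^+ 2 <= energy x v.
Proof.
move=> e0 v0 ex; rewrite /energy -[leLHS]addr0; apply: lerD.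
  by rewrite -[leRHS]real_normK ?num_real// lerXn2r// nnegrE.
apply: mulr_ge0; last exact: mart_ge0 v0.
by apply: mulr_ge0; apply: ltW; [exact: kappa_gt0|exact: scale_gt0 v0].
Qed.

(** From time [n] on, the energy centred at the value of the martingale at time
    [n]; before, the expectation of its value at time [n]. *)
Definition oscillation n v : R :=
  if (size v < n)%N then kappa * scale n * mart v
  else energy (mart (drop (size v - n) v)) v.

Lemma superharmonic_oscillation n : superharmonic (oscillation n).
Proof.
move=> v v0; rewrite /oscillation; case: ltnP => vn; last first.
  rewrite [leLHS](_ : _ = transition (energy (mart (drop (size v - n) v))) v).
    exact: superharmonic_energy.
  by rewrite /transition /= ltnNge (leqW vn)/= subSn.
rewrite [leLHS](_ : _ = transition (fun v => kappa * scale n * mart v) v).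
  by rewrite transitionZ transition_mart.
rewrite /transition /=; case: ltnP => // nv.
have -> : n = (size v).+1 by apply/eqP; rewrite eqn_leq nv vn.
by rewrite subnn /energy !subrr expr0n/= !add0r.
Qed.

(** The bound of [ruin_le_theta]; it is less than 1 because
    (kappa + 1/2)^2 - kappa (kappa + 1) = 1/4. *)
Definition theta : R := kappa * (kappa + 1) / (kappa + 2^-1) ^+ 2.

Lemma theta_gt0 : 0 < theta.
Proof.
rewrite /theta; move: kappa_gt0; move: kappa => k k0.
by rewrite divr_gt0 ?mulr_gt0 ?exprn_gt0 ?addr_gt0 ?invr_gt0.
Qed.

Lemma theta_lt1 : theta < 1.
Proof.
rewrite /theta; move: kappa_gt0; move: kappa => k k0.
rewrite ltr_pdivrMr ?exprn_gt0 ?addr_gt0 ?invr_gt0// mul1r.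
by rewrite -subr_gt0; have -> : (k + 2^-1) ^+ 2 - k * (k + 1) = 4^-1 by field.
Qed.

(** A Chebyshev bound for the probability that the martingale, having been [x],
    falls to [x / 2]. Centring the energy at [(kappa + 1) * x], above [x], is
    what makes the bound less than 1, as in the one-sided Chebyshev
    inequality. *)
Definition ruin x v : R := energy ((kappa + 1) * x) v / ((kappa + 2^-1) * x) ^+ 2.

Lemma ruin_ge0 x v : (0 < size v)%N -> 0 <= ruin x v.
Proof. by move=> v0; rewrite divr_ge0 ?energy_ge0 ?sqr_ge0. Qed.

Lemma superharmonic_ruin x : superharmonic (ruin x).
Proof.
move=> v v0.
rewrite /ruin; set D := (_ ^+ 2)^-1.
have -> : transition (fun v => energy ((kappa + 1) * x) v * D) v =
    transition (energy ((kappa + 1) * x)) v * D by rewrite /transition; ring.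
by rewrite ler_wpM2r ?invr_ge0 ?sqr_ge0// superharmonic_energy.
Qed.

Lemma ruin_ge1 x v : 0 < x -> (0 < size v)%N -> mart v <= x / 2 -> 1 <= ruin x v.
Proof.
move=> x0 v0 vx; have k0 := kappa_gt0.
have D0 : 0 < (kappa + 2^-1) * x.
  by apply: mulr_gt0 => //; apply: addr_gt0; rewrite ?invr_gt0.
rewrite /ruin ler_pdivlMr ?exprn_gt0// mul1r energy_ge ?(ltW D0)//.
by rewrite distrC (le_trans _ (ler_norm _))//; lra.
Qed.

(** Just after a step 1 the martingale m is at least the current scale u, so the
    energy kappa^2 m^2 + kappa u m is at most kappa (kappa + 1) m^2. *)
Lemma ruin_le_theta v : ruin (mart (true :: v)) (true :: v) <= theta.
Proof.
have k0 := kappa_gt0.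
have u0 : 0 < scale (size v).+1 by rewrite scale_gt0.
have um := mart_cons_ge v.
have m0 : 0 < mart (true :: v) by exact: lt_le_trans um.
rewrite /ruin /theta /energy [size _]/=; move: um m0.
move: u0; move: (mart _) (scale _) => m u u0 um m0.
move: k0; move: kappa => kappa k0.
rewrite ler_pdivrMr ?exprn_gt0 ?mulr_gt0 ?addr_gt0 ?invr_gt0//.
rewrite exprMn [leRHS]mulrA divfK ?gt_eqF ?exprn_gt0 ?addr_gt0 ?invr_gt0//.
have -> : m - (kappa + 1) * m = - (kappa * m) by ring.
rewrite sqrrN; apply: (@le_trans _ _ ((kappa * m) ^+ 2 + kappa * m * m)).
  by rewrite lerD2l; apply: ler_wpM2r; [exact: ltW|apply: ler_wpM2l => //; exact: ltW].
by rewrite le_eqVlt; apply/orP; left; apply/eqP; ring.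
Qed.

(** A gambler bets on the collapse of the martingale. The first component is
    [None] while waiting for the next step 1, and [Some x] during a bet placed
    when the martingale was [x] and won when it falls to [x / 2]; the second
    one counts the bets won. *)
Fixpoint bet v : option R * nat :=
  if v is b :: v' then
    match bet v' with
    | (None, j) => (if b then Some (mart v) else None, j)
    | (Some x, j) => if mart v <= x / 2 then (None, j.+1) else (Some x, j)
    end
  else (None, 0%N).

(** Each bet is won with probability at most [theta], so multiplying the stake by
    [theta^-1] at each win is at best fair; during a bet the capital is the
    value of the bet according to [ruin]. *)
Definition capital v : R :=
  match bet v with
  | (None, j) => theta^-1 ^+ j
  | (Some x, j) => theta^-1 ^+ j.+1 * ruin x v
  end.

Lemma bet_gt0 v x j : bet v = (Some x, j) -> 0 < x.
Proof.
elim: v x j => [//|b v IH] x j /=.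
case: (bet v) IH => [[y|] i] IH.
  by case: ifP => // _ [<- _]; exact: IH.
case: b => // -[<- _].
apply: lt_le_trans (mart_cons_ge v); exact: scale_gt0.
Qed.

Lemma capital_ge0 v : (0 < size v)%N -> 0 <= capital v.
Proof.
move=> v0; have t0 := theta_gt0; rewrite /capital; case: (bet v) => [[x|] j].
  by rewrite mulr_ge0 ?ruin_ge0// exprn_ge0// invr_ge0 ltW.
by rewrite exprn_ge0// invr_ge0 ltW.
Qed.

Lemma capital_start v j : theta^-1 ^+ j.+1 * ruin (mart (true :: v)) (true :: v)
  <= theta^-1 ^+ j.
Proof.
have t0 := theta_gt0.
rewrite exprSr -mulrA ler_piMr ?exprn_ge0 ?invr_ge0 ?(ltW t0)//.
by rewrite mulrC ler_pdivrMr// mul1r ruin_le_theta.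
Qed.

(** The capital does not increase when a bet is placed ([ruin_le_theta]) nor when
    it is won ([ruin_ge1]), and [ruin] is superharmonic in between. *)
Lemma superharmonic_capital : superharmonic capital.
Proof.
move=> v v0; have t0 := theta_gt0.
rewrite {2}/capital; case Ev : (bet v) => [[x|] j].
  pose f := fun w => theta^-1 ^+ j.+1 * ruin x w.
  apply: (@le_trans _ _ (transition f v)); last first.
    rewrite transitionZ ler_wpM2l ?exprn_ge0 ?invr_ge0 ?(ltW t0)//.
    exact: superharmonic_ruin.
  suff H b : capital (b :: v) <= f (b :: v) by apply: transition_le.
  rewrite /capital /= Ev /=; case: ifPn => // le; rewrite /f.
  rewrite ler_peMr ?exprn_ge0 ?invr_ge0 ?(ltW t0)//.
  by apply: ruin_ge1 => //; exact: bet_gt0 Ev.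
rewrite -[leRHS](transition_cst _ v).
apply: transition_le => //; rewrite /capital /= Ev //=.
exact: capital_start.
Qed.

Lemma capital1_le1 : capital [:: true] <= 1.
Proof. exact: (capital_start [::] 0). Qed.

End chain.

(** * Law of the history of the walk *)

Section almost_everywhere.
Context {R : realType} {d : measure_display} {T : measurableType d}.
Context (P : probability T R).

Lemma ae_measure_eq (A B : set T) : measurable A -> measurable B ->
  {ae P, forall w, A w <-> B w} -> P A = P B.
Proof.
move=> mA mB [N [mN N0 subN]].
have key (C : set T) : measurable C -> P C = P (C `&` ~` N).
  move=> mC; rewrite (measureDI P mC mN) setDE [X in (_ + X)%E](_ : _ = 0%E) ?adde0//.
  apply/eqP; rewrite eq_le measure_ge0 andbT -N0; apply: le_measure.
  - by apply/mem_set; exact: measurableI.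
  - exact/mem_set.
  - exact: subIsetr.
rewrite (key A)// (key B)//; congr (P _).
apply/seteqP; split=> w [Cw Nw]; split=> //.
  by have /contrapT/iffLR := contra_not (@subN w) Nw; apply.
by have /contrapT/iffRL := contra_not (@subN w) Nw; apply.
Qed.

Lemma negligible_eq0 (A : set T) : measurable A -> P A = 0%E -> {ae P, forall w, ~ A w}.
Proof. by move=> mA A0; exists A; split => // w /= /contrapT. Qed.

End almost_everywhere.

Section law.
Context {R : realType} {d : measure_display} {T : measurableType d}.
Context (P : probability T R) (p beta : R) (mu : nat -> R).
Context (memory : nat -> {RV P >-> nat}) (coin : nat -> {RV P >-> bool}).
Context (X : nat -> {RV P >-> nat}).

Hypothesis memory_law : forall n k : nat, (0 < n)%N ->
  P [set w | memory n.+1 w = k] =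
  (if (1 <= k <= n)%N then (beta + 1) / n%:R * (mu k / mu n.+1) else 0)%:E.
Hypothesis coin_law : forall n : nat, (0 < n)%N ->
  P [set w | coin n.+1 w = true] = p%:E.

Let index (i : nat + nat) : nat := match i with inl n | inr n => n end.

Let observable (i : nat + nat) : set (set T) :=
  match i with
  | inl n => preimage_set_system setT (memory n) measurable
  | inr n => preimage_set_system setT (coin n) measurable
  end.

Hypothesis memory_coin_independent : mutually_independent P
  [set i : nat + nat | match i with inl n | inr n => (1 < n)%N end] observable.
Hypothesis walk1 : forall w, X 1%N w = 1%N.
Hypothesis walkS : forall n : nat, (0 < n)%N ->
  {ae P, forall w, X n.+1 w = if coin n.+1 w then X (memory n.+1 w) w else 0%N}.

(** The almost sure properties of the choices, required at all times at once. *)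
Definition recursive (w : T) : Prop := forall n, (0 < n)%N ->
  X n.+1 w = (if coin n.+1 w then X (memory n.+1 w) w else 0%N) /\
  (1 <= memory n.+1 w <= n)%N.

Lemma measurable_eqnat (Y : {RV P >-> nat}) k : measurable [set w | Y w = k].
Proof. exact: (measurable_funPTI Y (Y := [set k])). Qed.

Lemma measurable_eqbool (Y : {RV P >-> bool}) b : measurable [set w | Y w = b].
Proof. exact: (measurable_funPTI Y (Y := [set b])). Qed.

Lemma ae_recursive : {ae P, forall w, recursive w}.
Proof.
have ae1 : {ae P, forall w n, (0 < n)%N ->
    X n.+1 w = if coin n.+1 w then X (memory n.+1 w) w else 0%N}.
  apply/ae_foralln => n; have [->|n0] := posnP n; first exact: aeW.
  by have := walkS n0; apply: filterS => w ->.
have ae2 : {ae P, forall w n k, (0 < n)%N -> memory n.+1 w = k -> (1 <= k <= n)%N}.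
  apply/ae_foralln => n; apply/ae_foralln => k.
  have [->|n0] := posnP n; first exact: aeW.
  have [kn|kn] := boolP (1 <= k <= n)%N; first exact: aeW.
  exists [set w | memory n.+1 w = k]; split; first exact: measurable_eqnat.
    by have := memory_law k n0; rewrite (negbTE kn).
  by move=> w /=; apply: contra_notP => mk _ /mk.
apply: filterS2 ae1 ae2 => w h1 h2 n n0; split; first exact: h1.
exact: h2.
Qed.

Lemma measure_ae_eq (A B : set T) : measurable A -> measurable B ->
  (forall w, recursive w -> A w <-> B w) -> P A = P B.
Proof.
move=> mA mB AB; apply: ae_measure_eq => //.
by apply: filterS ae_recursive => w; exact: AB.
Qed.

(** The steps are 0 or 1 almost surely; recording only their positivity gives
    finitely many histories at each time on the whole space. *)
Fixpoint hist n w : seq bool :=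
  if n is m.+1 then (0 < X n w)%N :: hist m w else [::].

Lemma size_hist n w : size (hist n w) = n.
Proof. by elim: n => //= n ->. Qed.

Lemma hist1 w : hist 1 w = [:: true].
Proof. by rewrite /= walk1. Qed.

Lemma nth_hist n k w : (0 < k <= n)%N -> nth false (hist n w) (n - k) = (0 < X k w)%N.
Proof.
elim: n => [|n IH]; first by case: k.
move=> /andP[k0]; rewrite leq_eqVlt => /predU1P[->|kn]; first by rewrite subnn.
by rewrite subSn//= IH// k0.
Qed.

Lemma measurable_hist n (v : seq bool) : measurable [set w | hist n w = v].
Proof.
elim: n v => [|n IH] [|b v].
- by rewrite (_ : mkset _ = setT)//; apply/seteqP.
- by rewrite (_ : mkset _ = set0)//; apply/seteqP; split => w.
- by rewrite (_ : mkset _ = set0)//; apply/seteqP; split => w.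
rewrite (_ : mkset _ = (X n.+1 @^-1` [set k | (0 < k)%N = b]) `&` [set w | hist n w = v]).
  by apply: measurableI => //; exact: measurable_funPTI.
by apply/seteqP; split => w /= [-> ->].
Qed.

(** Events specified by finitely many of the choices made after time [n]. *)
Definition future n (B : set T) : Prop :=
  exists (J : {fset (nat + nat)%type}) (A : nat + nat -> set T),
  [/\ forall i, i \in J -> (n < index i)%N,
      forall i, i \in J -> observable i (A i)
    & B = \bigcap_(i in [set` J]) A i].

Lemma futureT n : future n setT.
Proof.
exists fset0%fset, (fun=> setT); split=> //.
by apply/esym/seteqP; split.
Qed.

Lemma measurable_observable i A : observable i A -> measurable A.
Proof.
by case: i => n [B mB <-]; rewrite setTI; exact: measurable_funPTI.
Qed.

Lemma measurable_future n B : future n B -> measurable B.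
Proof.
move=> [J [A [_ oA ->]]]; apply: fin_bigcap_measurable => // i iJ.
exact: measurable_observable (oA _ iJ).
Qed.

(** A choice made at time [n.+1] joins the event as two more independent
    factors. *)
Lemma future_cons n k B : (0 < n)%N -> future n.+1 B ->
  let C := [set w | memory n.+1 w = k] `&` [set w | coin n.+1 w = true] `&` B in
  future n C /\
  P C = (P [set w | memory n.+1 w = k] * P [set w | coin n.+1 w = true] * P B)%E.
Proof.
move=> n0 [J [A [Jn oA BE]]] C.
pose A' (i : nat + nat) : set T := if i == inl n.+1 then [set w | memory n.+1 w = k]
  else if i == inr n.+1 then [set w | coin n.+1 w = true] else A i.
pose J' := (inl n.+1 |` (inr n.+1 |` J))%fset.
have lJ : inl n.+1 \notin J by apply/negP => /Jn /=; rewrite ltnn.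
have rJ : inr n.+1 \notin J by apply/negP => /Jn /=; rewrite ltnn.
have A'J i : i \in J -> A' i = A i.
  move=> iJ; rewrite /A'; case: eqVneq => [il|_]; first by rewrite -il iJ in lJ.
  by case: eqVneq => // ir; rewrite -ir iJ in rJ.
have oA' i : i \in J' -> observable i (A' i).
  rewrite !inE => /or3P[/eqP->|/eqP->|iJ].
  - by exists [set k]; rewrite ?setTI// /A' eqxx.
  - by exists [set true]; rewrite ?setTI// /A' eqxx.
  - by rewrite A'J//; exact: oA.
have CE : C = \bigcap_(i in [set` J']) A' i.
  apply/seteqP; split => w.
    move=> [[mw cw]]; rewrite BE => Bw i /=; rewrite !inE => /or3P[/eqP->|/eqP->|iJ].
    - by rewrite /A' eqxx.
    - by rewrite /A' eqxx.
    - by rewrite A'J//; exact: Bw.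
  move=> H; split; [split|].
  - by have := H (inl n.+1); rewrite /A' eqxx /= !inE eqxx; exact.
  - by have := H (inr n.+1); rewrite /A' eqxx /= !inE eqxx/=; exact.
  - rewrite BE => i /= iJ; rewrite -A'J//; apply: H => /=.
    by rewrite !inE iJ !orbT.
have J'1 i : i \in J' -> (n < index i)%N.
  by rewrite !inE => /or3P[/eqP->|/eqP->|/Jn]//=; apply: leq_trans.
split; first by exists J', A'; split.
have sub (K : {fset (nat + nat)%type}) : (forall i, i \in K -> (n < index i)%N) ->
    [set` K] `<=` [set i : nat + nat | match i with inl n | inr n => (1 < n)%N end].
  by move=> Kn [i|i] /= /Kn /= /(leq_ltn_trans n0).
rewrite CE memory_coin_independent//; last exact: sub.
rewrite BE (memory_coin_independent (A := A))//; last first.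
  by apply: sub => i /Jn; apply: leq_trans.
rewrite big_fsetU1/= ?big_fsetU1//; last by rewrite !inE.
rewrite -muleA; congr (_ * _)%E; first by rewrite /A' eqxx.
congr (_ * _)%E; first by rewrite /A' eqxx.
by rewrite big_seq [RHS]big_seq; apply: eq_bigr => i iJ; rewrite A'J.
Qed.

Let Pr (A : set T) : R := fine (P A).

Let PrK A : measurable A -> P A = (Pr A)%:E.
Proof. by move=> mA; rewrite fineK// fin_num_measure. Qed.

Lemma wsum_nth n v : size v = n ->
  wsum mu v = \sum_(i < n) mu i.+1 * (nth false v (n - i.+1))%:R.
Proof.
move=> <-; elim: v => [|b v IH] /=; first by rewrite big_ord0.
rewrite big_ord_recr/= subnn IH; congr (_ + _); apply: eq_bigr => i _.
by rewrite subSn.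
Qed.

Definition hist_independent n := forall v B, future n B ->
  Pr ([set w | hist n w = v] `&` B) = Pr [set w | hist n w = v] * Pr B.

(** The event that the next step is 1 splits according to the time that is
    remembered, which has to be one where the history has a 1. Each piece is a
    past event intersected with a future one. *)
Lemma hist_true n v B : (0 < n)%N -> hist_independent n -> future n.+1 B ->
  Pr ([set w | hist n.+1 w = true :: v] `&` B) =
  pstep p beta mu v * Pr [set w | hist n w = v] * Pr B.
Proof.
move=> n0 indep fB; have mB := measurable_future fB.
have [vn|/eqP vn] := eqVneq (size v) n; last first.
  rewrite (_ : [set w | hist n.+1 w = true :: v] = set0); last first.
    by apply/seteqP; split => w //= [_ h]; apply: vn; rewrite -h size_hist.
  rewrite (_ : [set w | hist n w = v] = set0); last first.
    by apply/seteqP; split => w //= h; apply: vn; rewrite -h size_hist.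
  by rewrite set0I /Pr measure0/= mulr0 mul0r.
pose C (i : nat) := [set w | memory n.+1 w = i.+1] `&` [set w | coin n.+1 w = true] `&` B.
pose F (i : 'I_n) := [set w | hist n w = v] `&` C i.
have mC i : measurable (C i).
  by apply: measurableI => //; apply: measurableI; [exact: measurable_eqnat|exact: measurable_eqbool].
have mF i : measurable (F i) by apply: measurableI; [exact: measurable_hist|].
have tF : trivIset setT F.
  apply/trivIsetP => i j _ _ ij; apply/seteqP; split => w //= [[_ [[mi _] _]] [_ [[mj _] _]]].
  by case/eqP: ij; apply/val_inj/succn_inj; rewrite -mi -mj.
pose Q := [pred i : 'I_n | nth false v (n - i.+1)].
have -> : Pr ([set w | hist n.+1 w = true :: v] `&` B) =
    Pr (\bigcup_(i in [set` Q]) F i).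
  congr fine; apply: measure_ae_eq.
  - by apply: measurableI => //; exact: measurable_hist.
  - exact: fin_bigcup_measurable.
  move=> w rec; have [Xn mn] := rec _ n0; split.
    move=> [/= [Xpos hv] Bw].
    have [cw Xm] : coin n.+1 w = true /\ (0 < X (memory n.+1 w) w)%N.
      by move: Xpos; rewrite Xn; case: (coin _ w).
    move: mn; case Em : (memory n.+1 w) => [//|i] /= mn.
    exists (Ordinal (mn : i < n)%N) => /=; last by split.
    by rewrite inE/= -hv nth_hist// -Em.
  move=> -[i /=]; rewrite inE /= => inth [/= hv [[/= mw /= cw] Bw]].
  by split=> //=; rewrite Xn cw mw -(@nth_hist n) ?ltn_ord// !hv inth.
rewrite bigcup_pred /Pr measure_bigsetU_ord//.
rewrite (eq_bigr (fun i : 'I_n => (Pr [set w | hist n w = v] *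
   ((beta + 1) / n%:R * (mu i.+1 / mu n.+1) * p * Pr B))%:E)); last first.
  move=> i _; transitivity (Pr (F i))%:E; first exact: PrK.
  congr EFin.
  have [fC PC] := future_cons i.+1 n0 fB.
  rewrite indep//; congr (_ * _).
  rewrite {1}/Pr PC (memory_law _ n0) (coin_law n0) ltn_ord PrK//.
rewrite sumEFin/= -big_distrr/=.
rewrite big_mkcond/= /pstep (wsum_nth vn) vn.
rewrite !(mulr_sumr, mulr_suml); apply: eq_bigr => i _.
rewrite inE /= -!/(Pr _) /alpha; case: (nth _ _ _); last by rewrite !(mulr0, mul0r).
by rewrite mulr1; ring.
Qed.

Lemma hist_false n v : (0 < n)%N ->
  [set w | hist n.+1 w = false :: v] =
  [set w | hist n w = v] `\` [set w | hist n.+1 w = true :: v].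
Proof.
move=> n0; apply/seteqP; split => w /=; first by move=> [-> ->]; split=> // -[].
by move=> [-> ne]; case: (0 < _)%N ne => // ne; exfalso; exact: ne.
Qed.

Lemma PrD (A B : set T) : measurable A -> measurable B -> B `<=` A ->
  Pr (A `\` B) = Pr A - Pr B.
Proof.
move=> mA mB BA; apply/eqP; rewrite -subr_eq opprK eq_sym; apply/eqP.
apply: EFin_inj; rewrite EFinD -!PrK//; last exact: measurableD.
by rewrite (measureDI P mA mB) setIidr.
Qed.

(** By induction on time: a history with last step 1 is handled by [hist_true],
    one with last step 0 by complementation. All future events have to be
    considered together, since [hist_true] moves the choices of one time from
    the future to the past. *)
Lemma hist_indep n : (0 < n)%N -> hist_independent n.
Proof.
elim: n => // -[_ _|n IH _] v B fB.
  have [->|vn] := eqVneq v [:: true].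
    rewrite (_ : [set w | hist 1 w = [:: true]] = setT).
      by rewrite setTI /Pr probability_setT mul1r.
    by apply/seteqP; split => // w _; exact: hist1.
  rewrite (_ : [set w | hist 1 w = v] = set0).
    by rewrite set0I /Pr measure0 mul0r.
  by apply/seteqP; split => // w; rewrite /mkset hist1 => h; rewrite -h eqxx in vn.
have {}IH := IH isT; have mB := measurable_future fB.
case: v => [|[] v].
- rewrite (_ : [set w | hist n.+2 w = [::]] = set0).
    by rewrite set0I /Pr measure0 mul0r.
  by apply/seteqP; split.
- rewrite hist_true//; congr (_ * _).
  apply/esym; rewrite -[X in Pr X = _]setIT hist_true//; last exact: futureT.
  by rewrite {2}/Pr probability_setT mulr1.
have mH := @measurable_hist n.+1 v; have mt := @measurable_hist n.+2 (true :: v).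
have tH : [set w | hist n.+2 w = true :: v] `<=` [set w | hist n.+1 w = v].
  by move=> w [_ hv].
have tE : Pr [set w | hist n.+2 w = true :: v] =
    pstep p beta mu v * Pr [set w | hist n.+1 w = v].
  rewrite -[X in Pr X = _]setIT hist_true//; last exact: futureT.
  by rewrite {2}/Pr probability_setT mulr1.
rewrite hist_false// (_ : (_ `\` _) `&` B = ([set w | hist n.+1 w = v] `&` B) `\`
    ([set w | hist n.+2 w = true :: v] `&` B)); last first.
  by apply/seteqP; split => w /= [[? ?] ?]; split=> //; [move=> []|split=> // ?; tauto].
rewrite !PrD//; [|exact: measurableI..|exact: setSI].
by rewrite hist_true// IH ?tE; [ring|move: fB => [J [A [h1 h2 h3]]]; exists J, A; split => // i /h1; exact: ltnW].
Qed.

(** The walk is a self-exciting chain: the law of the next step depends on the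
    choices made so far only through the history. *)
Lemma hist_step n v : (0 < n)%N ->
  P [set w | hist n.+1 w = true :: v] =
    ((pstep p beta mu v)%:E * P [set w | hist n w = v])%E /\
  P [set w | hist n.+1 w = false :: v] =
    ((1 - pstep p beta mu v)%:E * P [set w | hist n w = v])%E.
Proof.
move=> n0; have mH := @measurable_hist n v; have mt := @measurable_hist n.+1 (true :: v).
have tH : [set w | hist n.+1 w = true :: v] `<=` [set w | hist n w = v].
  by move=> w [_ hv].
have tE : Pr [set w | hist n.+1 w = true :: v] =
    pstep p beta mu v * Pr [set w | hist n w = v].
  rewrite -[X in Pr X = _]setIT hist_true//; [|exact: hist_indep|exact: futureT].
  by rewrite {2}/Pr probability_setT mulr1.
rewrite hist_false// !PrK//; last exact: measurableD.
by rewrite PrD// tE -!EFinM; split=> //; rewrite mulrBl mul1r.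
Qed.

End law.

(** * Ville's inequality and its consequences *)

Section measure_facts.
Context {R : realType} {d : measure_display} {T : measurableType d}.
Context (P : probability T R).

Lemma measure_bigcup_le (F : nat -> set T) (x : \bar R) :
  (forall n, measurable (F n)) -> nondecreasing_seq F ->
  (forall n, P (F n) <= x)%E -> (P (\bigcup_n F n) <= x)%E.
Proof.
move=> mF ndF Fx.
have cF := nondecreasing_cvg_mu (mu := P) mF (bigcup_measurable (fun k _ => mF k)) ndF.
rewrite -(cvg_lim (@ereal_hausdorff R) cF)//.
by apply: lime_le; [apply/cvg_ex; eexists; exact: cF|exact: nearW].
Qed.

Lemma le_all_eq0 (F : nat -> set T) (x : nat -> R) :
  (forall n, measurable (F n)) -> (forall n, P (F n) <= (x n)%:E)%E ->
  x n @[n --> \oo] --> 0 -> P (\bigcap_n F n) = 0%E.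
Proof.
move=> mF Fx x0; have mI : measurable (\bigcap_n F n) by exact: bigcap_measurable.
apply/eqP; rewrite eq_le measure_ge0 andbT.
have cx : (x n)%:E @[n --> \oo] --> 0%E by apply: cvg_EFin => //; exact: nearW.
rewrite -(cvg_lim (@ereal_hausdorff R) cx)//.
apply: lime_ge; first by apply/cvg_ex; eexists; exact: cx.
apply: nearW => n; apply: le_trans (Fx n).
by apply: le_measure; [exact/mem_set|exact/mem_set|exact: bigcap_inf].
Qed.

End measure_facts.

Section ville.
Context {R : realType} {d : measure_display} {T : measurableType d}.
Context (P : probability T R) (p beta : R) (mu c : nat -> R).
Context (X : nat -> {RV P >-> nat}).
Hypotheses (p01 : 0 < p < 1) (b01 : 0 < beta < p / (1 - p)).
Hypotheses (Hmu : rising beta mu) (Hc : rising (alpha p beta) c).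
Hypothesis X1 : forall w, X 1%N w = 1%N.
Hypothesis step : forall n v, (0 < n)%N ->
  P [set w | hist X n.+1 w = true :: v] =
    ((pstep p beta mu v)%:E * P [set w | hist X n w = v])%E /\
  P [set w | hist X n.+1 w = false :: v] =
    ((1 - pstep p beta mu v)%:E * P [set w | hist X n w = v])%E.
Local Notation superharmonic := (superharmonic p beta mu).
Local Notation hist := (hist X).
Implicit Types (h : seq bool -> R) (v : seq bool).

Lemma measurable_hist_in n (D : set (seq bool)) : measurable [set w | D (hist n w)].
Proof.
rewrite (_ : [set w | _] = \bigcup_v ([set w | hist n w = v /\ D v])).
  apply: countable_bigcupT_measurable => [|v]; first exact: countableP.
  have [Dv|nDv] := pselect (D v).
    rewrite (_ : mkset _ = [set w | hist n w = v]); first exact: measurable_hist.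
    by apply/seteqP; split => w //= [].
  by rewrite (_ : mkset _ = set0)//; apply/seteqP; split => w //= [].
apply/seteqP; split => w /=; first by move=> Dw; exists (hist n w).
by move=> [v _ [-> ]].
Qed.

Definition crosses h n m : set T :=
  [set w | exists2 k, (k <= m)%N & 1 <= h (hist (n + k) w)].

Lemma measurable_crosses h n m : measurable (crosses h n m).
Proof.
rewrite (_ : crosses h n m =
    \bigcup_(k in [set k | (k <= m)%N]) [set w | [set v | 1 <= h v] (hist (n + k) w)]).
  by apply: bigcup_measurable => k _; exact: measurable_hist_in.
by apply/seteqP; split => w /= [k km hk]; exists k.
Qed.

(** Backward induction on the horizon: after one step the bound is the transition
    of [h], which is at most [h]. *)
Lemma ville_horizon h m n v : superharmonic h ->
  (forall v, (0 < size v)%N -> 0 <= h v) -> (0 < n)%N ->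
  (P ([set w | hist n w = v] `&` crosses h n m) <= (h v)%:E * P [set w | hist n w = v])%E.
Proof.
move=> sh h0; elim: m n v => [|m IH] n v n0.
all: have mH := @measurable_hist R d T P X n v.
all: have mC k := measurable_crosses h n k.
all: have [vn|vn] := eqVneq (size v) n; last first.
1,3: rewrite (_ : [set w | hist n w = v] = set0);
  [by rewrite set0I measure0 mule0|
   by apply/seteqP; split => w //= hv; rewrite -hv size_hist eqxx in vn].
all: have [h1|h1] := leP 1 (h v).
1,3: apply: (@le_trans _ _ (P [set w | hist n w = v]));
  [by apply: le_measure; [apply/mem_set; exact: measurableI|exact/mem_set|exact: subIsetl]|
   by rewrite -[leLHS]mul1e; apply: lee_wpmul2r; rewrite ?measure_ge0 ?lee_fin].
  rewrite (_ : _ `&` _ = set0).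
    by rewrite measure0 mule_ge0// lee_fin h0// vn.
  apply/seteqP; split => w //= [hv [k]]; rewrite leqn0 => /eqP ->.
  by rewrite addn0 hv leNgt h1.
pose F b := [set w | hist n.+1 w = b :: v] `&` crosses h n.+1 m.
have mF b : measurable (F b).
  by apply: measurableI; [exact: measurable_hist|exact: measurable_crosses].
apply: (@le_trans _ _ (P (F true `|` F false))).
  apply: le_measure; [apply/mem_set; exact: measurableI|apply/mem_set; exact: measurableU|].
  move=> w [/= hv [[|k] km hk]]; first by move: hk; rewrite addn0 hv leNgt h1.
  have cr : crosses h n.+1 m w by exists k => //; rewrite addSnnS.
  by case E : (0 < X n.+1 w)%N; [left|right]; split=> //=; rewrite hv E.
apply: (@le_trans _ _ (P (F true) + P (F false))%E); first exact: measureU2.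
apply: (@le_trans _ _ ((h (true :: v))%:E * P [set w | hist n.+1 w = true :: v] +
    (h (false :: v))%:E * P [set w | hist n.+1 w = false :: v])%E).
  by apply: leeD; exact: IH.
have [-> ->] := step v n0.
rewrite !muleA -!EFinM -ge0_muleDl ?lee_fin; last 2 first.
- by rewrite mulr_ge0 ?h0//; exact: pstep_ge0.
- by rewrite mulr_ge0 ?h0// subr_ge0; apply: pstep_le1.
apply: lee_wpmul2r; rewrite ?measure_ge0// -EFinD lee_fin.
by rewrite mulrC [X in _ + X]mulrC; apply: sh; rewrite vn.
Qed.

Definition reaches h (e : R) : set T :=
  [set w | exists n, e <= h (hist n.+1 w)].

(** Ville's maximal inequality for nonnegative supermartingales. *)
Lemma ville h (e : R) : superharmonic h ->
  (forall v, (0 < size v)%N -> 0 <= h v) -> 0 < e ->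
  (P (reaches h e) <= (h [:: true] / e)%:E)%E.
Proof.
move=> sh h0 e0; pose g v := h v / e.
have sg : superharmonic g.
  move=> v v0; rewrite (_ : transition _ _ _ _ _ = transition p beta mu h v / e).
    by rewrite ler_pM2r ?invr_gt0//; exact: sh.
  by rewrite /transition /g; ring.
have g0 v : (0 < size v)%N -> 0 <= g v by move=> v0; rewrite divr_ge0 ?h0 ?ltW.
rewrite (_ : reaches h e = \bigcup_m crosses g 1 m).
  apply: measure_bigcup_le => [n|n m nm|m]; first exact: measurable_crosses.
    by apply/subsetPset => w [k kn gk]; exists k => //; exact: leq_trans nm.
  have := @ville_horizon g m 1 [:: true] sg g0 isT.
  rewrite (_ : [set w | hist 1 w = [:: true]] = setT).
    by rewrite setTI probability_setT mule1.
  by apply/seteqP; split => // w _; exact: hist1.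
apply/seteqP; split => w /= [k].
  by move=> ek; exists k => //; exists k => //; rewrite ler_pdivlMr// mul1r add1n.
by move=> _ [n _]; rewrite ler_pdivlMr// mul1r => en; exists n.
Qed.

Local Notation kappa := (kappa p beta).
Local Notation alpha := (alpha p beta).
Local Notation theta := (theta p beta).
Local Notation scale := (scale mu c).
Local Notation mart := (mart mu c).
Local Notation ruin := (ruin p beta mu c).
Local Notation capital := (capital p beta mu c).
Local Notation bet := (bet mu c).

Lemma measurable_reaches h e : measurable (reaches h e).
Proof.
rewrite (_ : reaches h e = \bigcup_n [set w | [set v | e <= h v] (hist n.+1 w)]).
  by apply: bigcup_measurable => n _; exact: measurable_hist_in.
by apply/seteqP; split => w /= [n]; [exists n|exists n].
Qed.

Lemma drop_hist m n w : (n <= m)%N -> drop (m - n) (hist m w) = hist n w.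
Proof.
elim: m => [|m IH]; first by rewrite leqn0 => /eqP ->.
rewrite leq_eqVlt => /predU1P[->|nm]; first by rewrite subnn drop0.
by rewrite subSn//= IH.
Qed.

Lemma mart1 : mart [:: true] = 1.
Proof. by rewrite /mart /= Hmu.1 Hc.1 add0r mulr1 divr1. Qed.

Definition oscillates n (e : R) : set T :=
  [set w | exists2 m, (n <= m)%N & e <= `|mart (hist m w) - mart (hist n w)|].

Lemma measurable_oscillates n e : measurable (oscillates n e).
Proof.
rewrite (_ : oscillates n e = \bigcup_(m in [set m | (n <= m)%N])
    [set w | [set v | e <= `|mart v - mart (drop (m - n) v)|] (hist m w)]).
  by apply: bigcup_measurable => m _; exact: measurable_hist_in.
apply/seteqP; split => w /= [m nm]; first by move=> ?; exists m => //=; rewrite drop_hist.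
by rewrite /= drop_hist// => ?; exists m.
Qed.

Lemma oscillates_le n e : (0 < n)%N -> 0 < e ->
  (P (oscillates n e) <= (kappa * scale n / e ^+ 2)%:E)%E.
Proof.
move=> n0 e0; pose h := oscillation p beta mu c n.
have sh : superharmonic h by exact: superharmonic_oscillation.
have h0 v : (0 < size v)%N -> 0 <= h v.
  move=> v0; rewrite /h /oscillation; case: ltnP => _; last exact: energy_ge0.
  apply: mulr_ge0; last exact: (mart_ge0 p01 b01 Hmu Hc v0).
  apply: mulr_ge0; apply: ltW; first exact: kappa_gt0.
  exact: (scale_gt0 p01 b01 Hmu Hc n0).
have := ville sh h0 (exprn_gt0 2 e0).
have -> : h [:: true] = kappa * scale n.
  rewrite /h /oscillation /=; case: ltnP => n1; first by rewrite mart1 mulr1.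
  have -> : n = 1%N by apply/eqP; rewrite eqn_leq n1 n0.
  by rewrite subnn drop0 /energy subrr expr0n/= add0r mart1 mulr1.
apply: le_trans; apply: le_measure.
- exact/mem_set/measurable_oscillates.
- exact/mem_set/measurable_reaches.
move=> w [[|m]] nm em; first by rewrite leqNgt n0 in nm.
exists m; rewrite /h /oscillation size_hist ltnNge nm /= -/(hist m.+1 w).
by rewrite drop_hist//; apply: energy_ge => //; exact: ltW.
Qed.

(** The martingale is almost surely a Cauchy sequence, since the probability of
    an oscillation of size [e] after time [n] is of order [scale n]. *)
Lemma ae_cvg_mart : scale n @[n --> \oo] --> 0 ->
  {ae P, forall w, cvgn (fun n => mart (hist n w))}.
Proof.
move=> u0.
have H : {ae P, forall w j, ~ (\bigcap_n oscillates n.+1 (j.+1%:R^-1)) w}.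
  apply/ae_foralln => j; apply: negligible_eq0.
    by apply: bigcap_measurable => // n _; exact: measurable_oscillates.
  apply: (le_all_eq0 (x := fun n => kappa * scale n.+1 / (j.+1%:R^-1) ^+ 2)).
  - by move=> n; exact: measurable_oscillates.
  - by move=> n; apply: oscillates_le => //; rewrite invr_gt0.
  rewrite -(mul0r (((j.+1%:R^-1 : R) ^+ 2)^-1)) -(mulr0 kappa).
  apply: cvgMl; apply: cvgMr.
  by have := u0; rewrite -cvg_shiftS; exact.
apply: filterS H => w Hw.
apply/cvgn_cauchyP => j.
have [n nosc] : exists n, ~ oscillates n.+1 (j.+1%:R^-1) w.
  by apply/existsNP => all; apply: (Hw j) => n _; exact: all.
exists n.+1 => m nm; rewrite ltNge; apply/negP => le.
by apply: nosc; exists m.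
Qed.

Lemma bet_start n m j w : bet (hist n w) = (None, j) -> (n < m)%N -> (0 < X m w)%N ->
  exists k x, bet (hist k w) = (Some x, j).
Proof.
move=> bn nm; rewrite -(subnKC nm); move: (m - n.+1)%N => i {nm}.
elim: i n bn => [|i IH] n bn Xm.
  by rewrite addn0 in Xm; exists n.+1, (mart (hist n.+1 w)); rewrite /= bn Xm.
have [X0|X0] := boolP (0 < X n.+1 w)%N.
  by exists n.+1, (mart (hist n.+1 w)); rewrite /= bn X0.
by apply: (IH n.+1); [rewrite /= bn (negbTE X0)|rewrite addSnnS].
Qed.

Lemma bet_end n m x j w : bet (hist n w) = (Some x, j) -> (n < m)%N ->
  mart (hist m w) <= x / 2 -> exists k, bet (hist k.+1 w) = (None, j.+1).
Proof.
move=> bn nm; rewrite -(subnKC nm); move: (m - n.+1)%N => i {nm}.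
elim: i n bn => [|i IH] n bn Mm.
  by rewrite addn0 in Mm; exists n; rewrite /= bn; move: Mm => /= ->.
have [M0|M0] := boolP (mart (hist n.+1 w) <= x / 2).
  by exists n; rewrite /= bn; move: M0 => /= ->.
apply: (IH n.+1); last by rewrite addSnnS.
by rewrite /= bn; move: M0 => /= /negbTE ->.
Qed.

Definition infinitely_often w := forall N, exists2 n, (N <= n)%N & (0 < X n w)%N.

(** Infinitely many steps 1 let the gambler place a new bet after each win, and
    the collapse of the martingale makes each bet a winning one. *)
Lemma bet_rounds w j : infinitely_often w -> mart (hist n w) @[n --> \oo] --> 0 ->
  exists k, bet (hist k.+1 w) = (None, j.+1).
Proof.
move=> io M0.
have next n i : bet (hist n w) = (None, i) -> exists k, bet (hist k.+1 w) = (None, i.+1).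
  move=> bn; have [m nm Xm] := io n.+1.
  have [k [x bk]] := bet_start bn nm Xm.
  have x0 : 0 < x / 2 by rewrite divr_gt0//; exact: (bet_gt0 p01 b01 Hmu Hc bk).
  have /cvgr_lt/(_ _ x0) [N _ HN] := M0.
  apply: (@bet_end k (maxn N k.+1)) bk _ _; first by rewrite leq_max leqnn orbT.
  by apply/ltW/HN => /=; rewrite leq_maxl.
elim: j => [|j [k bk]]; first exact: (next 0%N 0%N).
exact: next bk.
Qed.

(** Where the walk has infinitely many steps 1 and the martingale vanishes, the
    capital reaches every power of [theta^-1], which Ville's inequality allows
    only on a null event. *)
Lemma ae_escape : {ae P, forall w, infinitely_often w ->
  ~ (mart (hist n w) @[n --> \oo] --> 0)}.
Proof.
have t0 : 0 < theta by exact: theta_gt0.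
have t1 : theta < 1 by exact: theta_lt1.
pose F j := reaches capital (theta^-1 ^+ j.+1).
have mF j : measurable (F j) by exact: measurable_reaches.
have H : {ae P, forall w, ~ (\bigcap_j F j) w}.
  apply: negligible_eq0; first exact: bigcap_measurable.
  apply: (le_all_eq0 (x := fun j => theta ^+ j.+1)) => // [j|].
    apply: (le_trans (ville _ _ _)).
    - exact: superharmonic_capital.
    - by move=> v; exact: capital_ge0.
    - by rewrite exprn_gt0// invr_gt0.
    rewrite lee_fin exprVn invrK ler_piMl ?exprn_ge0 ?(ltW t0)//.
    exact: capital1_le1.
  rewrite (cvg_shiftS (fun j => theta ^+ j)).
  by apply: cvg_expr; rewrite ger0_norm// ltW.
apply: filterS H => w Hw io M0; apply: Hw => j _.
have [k bk] := bet_rounds j io M0.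
by exists k; rewrite /capital bk.
Qed.

(** The energy bound already holds from the start, since the first step is 1. *)
Lemma dies_le : (P (reaches (ruin 1) 1) <= theta%:E)%E.
Proof.
apply: (le_trans (ville _ _ _)).
- exact: superharmonic_ruin.
- by move=> v; exact: ruin_ge0.
- by [].
by rewrite divr1 lee_fin -{1}mart1; apply: ruin_le_theta.
Qed.

(** The history whose only step 1 is the first one. *)
Fixpoint lonely n : seq bool := if n is m.+1 then false :: lonely m else [:: true].

Lemma size_lonely n : size (lonely n) = n.+1.
Proof. by elim: n => //= n ->. Qed.

Lemma wsum_lonely n : wsum mu (lonely n) = 1.
Proof. by elim: n => [|n IH] /=; rewrite ?IH ?mulr0 ?addr0// Hmu.1 add0r mulr1. Qed.

(** The probability of leaving a lonely history telescopes, so that these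
    probabilities are summable. *)
Lemma pstep_lonely n : pstep p beta mu (lonely n) =
  alpha / beta * ((mu n.+1)^-1 - (mu n.+2)^-1).
Proof.
have b0 : 0 < beta by case/andP: b01.
have m1 : 0 < mu n.+1 by exact: (mu_gt0 b01 Hmu).
rewrite /pstep wsum_lonely size_lonely Hmu.2//.
have n0 : 0 < n.+1%:R :> R by rewrite ltr0n.
move: (n.+1%:R) n0 m1 => x x0; move: (mu _) => y y0.
by field; rewrite !gt_eqF ?addr_gt0.
Qed.

(** Once the remaining sum of the probabilities of leaving is at most 1/2, at
    least half of the probability of being lonely is kept forever. *)
Lemma lonely_ge : mu n @[n --> \oo] --> +oo ->
  exists2 e : R, 0 < e & forall n, (e%:E <= P [set w | hist n.+1 w = lonely n])%E.
Proof.
move=> muoo; have b0 : 0 < beta by case/andP: b01.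
have a0 : 0 < alpha by exact: alpha_gt0.
pose q n := fine (P [set w | hist n.+1 w = lonely n]).
have PE n : P [set w | hist n.+1 w = lonely n] = (q n)%:E.
  by rewrite fineK// fin_num_measure//; exact: measurable_hist.
have q0 : q 0%N = 1.
  rewrite /q (_ : [set w | _] = setT) ?probability_setT//.
  by apply/seteqP; split => // w _; exact: hist1.
have qS n : q n.+1 = (1 - pstep p beta mu (lonely n)) * q n.
  by apply: EFin_inj; rewrite EFinM -!PE; have [_ <-] := step (lonely n) (ltn0Sn n).
have pl n : pstep p beta mu (lonely n) < 1.
  apply: le_lt_trans (_ : p < 1); last by case/andP: p01.
  exact: pstep_le.
have pge n : 0 <= pstep p beta mu (lonely n) by exact: pstep_ge0.
have qpos n : 0 < q n.
  by elim: n => [|n IH]; rewrite ?q0// qS mulr_gt0// subr_gt0.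
have qdec n m : (n <= m)%N -> q m <= q n.
  move=> nm; rewrite -(subnKC nm); elim: (m - n)%N => [|i IH]; first by rewrite addn0.
  by rewrite addnS qS; apply: le_trans IH; rewrite ler_piMl ?(ltW (qpos _))// gerBl.
have [N muN] : exists N, alpha / beta / mu N.+1 <= 2^-1.
  have /cvgryPge/(_ (2 * (alpha / beta))) [N _ HN] := muoo.
  exists N; have mN : 0 < mu N.+1 by exact: (mu_gt0 b01 Hmu).
  rewrite ler_pdivrMr//; have /= := HN _ (leqnSn N).
  by move: (alpha / beta) (mu _) => x y; lra.
have qN m : q N * (1 - alpha / beta * ((mu N.+1)^-1 - (mu (N + m).+1)^-1)) <= q (N + m)%N.
  elim: m => [|m IH]; first by rewrite addn0 subrr mulr0 subr0 mulr1.
  rewrite addnS qS.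
  have H := ler_wpM2l (_ : 0 <= 1 - pstep p beta mu (lonely (N + m))) IH.
  apply: le_trans (H _); last by rewrite subr_ge0 ltW.
  have : 0 <= pstep p beta mu (lonely (N + m)) * (alpha / beta * ((mu N.+1)^-1 - (mu (N + m).+1)^-1)).
    apply: mulr_ge0 => //; apply: mulr_ge0; first by rewrite divr_ge0 ?ltW.
    elim: m {IH H} => [|m IH]; first by rewrite addn0 subrr.
    have := pge (N + m)%N; rewrite pstep_lonely pmulr_rge0 ?divr_gt0// addnS; lra.
  move=> sq; rewrite [leRHS]mulrCA; apply: ler_wpM2l; first exact: ltW.
  rewrite pstep_lonely in sq *.
  by move: sq; move: (alpha / beta) (mu _)^-1 (mu _)^-1 (mu _)^-1 => r x y z; nra.
exists (q N / 2); first by rewrite divr_gt0.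
move=> n; rewrite PE lee_fin; have [nN|Nn] := leqP n N.
  apply: le_trans (qdec _ _ nN); rewrite ler_pdivrMr// ler_peMr ?(ltW (qpos _))//.
  by rewrite ler1n.
rewrite -(subnKC (ltnW Nn)); apply: le_trans (qN _).
rewrite ler_wpM2l ?(ltW (qpos _))//.
have : 0 <= alpha / beta * (mu (N + (n - N)).+1)^-1.
  by rewrite mulr_ge0 ?divr_ge0 ?invr_ge0 ?(ltW a0) ?(ltW b0)// ltW//; exact: (mu_gt0 b01 Hmu).
by rewrite mulrBr; move: muN; lra.
Qed.

Lemma lonely_gt0 : mu n @[n --> \oo] --> +oo ->
  (0 < P (\bigcap_n [set w | hist n.+1 w = lonely n]))%E.
Proof.
move=> /lonely_ge [e e0 He]; pose F n := [set w | hist n.+1 w = lonely n].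
have mF n : measurable (F n) by exact: measurable_hist.
have mI : measurable (\bigcap_n F n) by exact: bigcap_measurable.
have : (P (\bigcup_n ~` F n) <= (1 - e)%:E)%E.
  apply: measure_bigcup_le => [n|n m nm|n]; first exact: measurableC.
    apply/subsetPset; apply: subsetC => w; rewrite /F /= -(subnKC nm).
    elim: (m - n)%N => [|i IH]; first by rewrite addn0.
    by rewrite addnS => -[_ /IH].
  rewrite [X in (X <= _)%E]probability_setC// EFinB leeB//; exact: He.
rewrite -setC_bigcap probability_setC//.
have : P (\bigcap_n F n) \is a fin_num by rewrite fin_num_measure.
move/fineK => <-; rewrite -EFinB lee_fin lte_fin => H.
by apply: lt_le_trans e0 _; move: H; lra.
Qed.

End ville.

(** * From weighted sums to sums *)

Section asymptotics.
Context {R : realType}.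

(** The Stolz theorem, with increments of [D] given as multiples of those of
    [r]. *)
Lemma weighted_cesaro (D r y : nat -> R) (l : R) :
  (forall n, (0 < n)%N -> D n.+1 - D n = y n * (r n.+1 - r n)) ->
  (forall n, (0 < n)%N -> r n <= r n.+1) ->
  r n @[n --> \oo] --> +oo -> y n @[n --> \oo] --> l ->
  D n / r n @[n --> \oo] --> l.
Proof.
move=> DS rS roo yl; apply/cvgrPdist_le => e e0.
have e20 : 0 < e / 2 by rewrite divr_gt0.
have /cvgrPdist_le /(_ _ e20) [N _ HN] := yl.
pose E n := D n - l * r n.
have EN n : (N.+1 <= n)%N -> `|E n| <= `|E N.+1| + e / 2 * (r n - r N.+1).
  move=> Nn; rewrite -(subnKC Nn); elim: (n - N.+1)%N => [|i IH].
    by rewrite addn0 subrr mulr0 addr0.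
  rewrite addnS; set k := (N.+1 + i)%N in IH *.
  have -> : E k.+1 = E k + (y k - l) * (r k.+1 - r k).
    have := DS k isT; rewrite /E => /(canRL (subrK _)) ->; ring.
  apply: le_trans (ler_normD _ _) _.
  rewrite normrM [X in _ + _ * X]ger0_norm ?subr_ge0 ?rS//.
  have yk : `|y k - l| <= e / 2.
    by rewrite distrC; apply: HN; rewrite /= /k addSn leqW// leq_addr.
  have H : `|y k - l| * (r k.+1 - r k) <= e / 2 * (r k.+1 - r k).
    by rewrite ler_wpM2r// subr_ge0 rS.
  by move: IH H; rewrite !mulrBr; lra.
have rbig := (cvgryPge _).1 roo.
near=> n.
have Nn : (N.+1 <= n)%N by near: n; exact: nbhs_infty_ge.
have r1 : 1 <= r n by near: n; exact: rbig.
have r2 : (`|E N.+1| + e / 2 * `|r N.+1|) / (e / 2) <= r n by near: n; exact: rbig.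
have rn0 : 0 < r n by exact: lt_le_trans r1.
have -> : l - D n / r n = - (E n / r n) by rewrite /E; field; rewrite gt_eqF.
rewrite normrN normrM normfV (gtr0_norm rn0) ler_pdivrMr//.
apply: le_trans (EN n Nn) _.
move: r2; rewrite ler_pdivrMr// => r2.
have H : - (e / 2 * r N.+1) <= e / 2 * `|r N.+1|.
  by rewrite -mulrN ler_wpM2l ?(ltW e20)// -normrN ler_norm.
by rewrite mulrBr; move: r2 H; lra.
Unshelve. all: by end_near. Qed.

Context (p beta : R) (mu c : nat -> R).
Hypotheses (p01 : 0 < p < 1) (b01 : 0 < beta < p / (1 - p)).
Hypotheses (Hmu : rising beta mu) (Hc : rising (alpha p beta) c).

(** By Abel summation the sum of the steps minus the weighted sum divided by
    [mu n] has increments equal to (kappa - 1) times the normalised weighted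
    sum times the increment of [c n / mu n]; [weighted_cesaro] applies. *)
Lemma cvg_sum_of_weighted (x : nat -> R) (l : R) :
  (c n / mu n) @[n --> \oo] --> +oo ->
  (\sum_(1 <= k < n.+1) mu k * x k) / c n @[n --> \oo] --> l ->
  (\sum_(1 <= k < n.+1) x k) / (c n / mu n) @[n --> \oo] --> kappa p beta * l.
Proof.
set Sg := fun n => \sum_(1 <= k < n.+1) mu k * x k.
set S := fun n => \sum_(1 <= k < n.+1) x k.
move=> roo Ml.
have b0 : 0 < beta by case/andP: b01.
have a0 : 0 < alpha p beta by exact: alpha_gt0.
have ab0 : 0 < alpha p beta - beta by rewrite subr_gt0 beta_lt_alpha.
have m0 n : (0 < n)%N -> 0 < mu n by exact: (mu_gt0 b01 Hmu).
have c0 n : (0 < n)%N -> 0 < c n by exact: (c_gt0 p01 b01 Hc).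
have rS n : (0 < n)%N -> c n.+1 / mu n.+1 - c n / mu n =
    c n / mu n * ((alpha p beta - beta) / (n%:R + beta)).
  move=> n0; have n0' : 0 < n%:R :> R by rewrite ltr0n.
  rewrite Hmu.2// Hc.2//; have := m0 n n0; move: (mu n) (c n) (n%:R) n0' => u v y y0 u0.
  by field; rewrite !gt_eqF ?addr_gt0.
have : (S n - Sg n / mu n) / (c n / mu n) @[n --> \oo] --> (kappa p beta - 1) * l.
  apply: (@weighted_cesaro _ _ (fun n => (kappa p beta - 1) * (Sg n / c n))).
  - move=> n n0; rewrite rS// /S /Sg !(big_nat_recr n.+1)//= -/(S n) -/(Sg n).
    have n0' : 0 < n%:R :> R by rewrite ltr0n.
    rewrite Hmu.2// /kappa; have := m0 n n0; have := c0 n n0.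
    move: (alpha p beta) a0 ab0 => a a0 ab0.
    move: (mu n) (c n) (n%:R) (x _) (S n) (Sg n) n0' => u v y xx s sg y0 v0 u0.
    by field; rewrite (gt_eqF ab0) !gt_eqF ?addr_gt0.
  - move=> n n0; rewrite -subr_ge0 rS//.
    apply: mulr_ge0; apply: divr_ge0; rewrite ?(ltW (c0 n n0)) ?(ltW (m0 n n0)) ?(ltW ab0)//.
    by rewrite addr_ge0// ltW.
  - exact: roo.
  - exact: cvgMr.
move=> H.
have -> : kappa p beta * l = (kappa p beta - 1) * l + l by ring.
apply: (@eq_pos_cvg _ _ (fun n => (S n - Sg n / mu n) / (c n / mu n) + Sg n / c n)); last exact: cvgD.
move=> n n0.
have := m0 n n0; have := c0 n n0; rewrite -/(S n) -/(Sg n).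
move: (mu n) (c n) => u v v0 u0; by field; rewrite !gt_eqF.
Qed.

End asymptotics.

Section Gamma_weights.
Context {R : realType} (p beta : R).
Hypotheses (p01 : 0 < p < 1) (b01 : 0 < beta < p / (1 - p)).
Local Notation alpha := (alpha p beta).

(** The powers of n in the asymptotics of the two weights combine into the growth
    rate of the walk. *)
Lemma ratio_asymp :
  (cn alpha n / mun beta n) / n%:R `^ (alpha - beta) @[n --> \oo] -->
  Gamma (beta + 1) / Gamma (alpha + 1).
Proof.
have b0 : 0 < beta by case/andP: b01.
have a0 : 0 < alpha by exact: alpha_gt0.
have ca := mun_asymp a0; have cb := mun_asymp b0.
have Gb : 0 < Gamma (beta + 1) by rewrite Gamma_gt0// addr_gt0.
have cb' : (mun beta n / n%:R `^ beta)^-1 @[n --> \oo] --> Gamma (beta + 1).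
  by rewrite -[X in _ --> X]invrK; apply: cvgV => //; rewrite invr_eq0 gt_eqF.
rewrite mulrC; apply: (eq_pos_cvg _ (cvgM ca cb')) => n n0 /=.
have n0' : 0 < n%:R :> R by rewrite ltr0n.
rewrite powRB ?(gt_eqF n0') ?implybT//.
have pa : 0 < n%:R `^ alpha :> R by exact: powR_gt0.
have pb : 0 < n%:R `^ beta :> R by exact: powR_gt0.
have mb := mun_gt0 b0 n0.
change (cn alpha n) with (mun alpha n).
move: pa pb mb; move: (mun _ _) (mun _ _) (_ `^ _) (_ `^ _) => x y z t z0 t0 x0.
by field; rewrite !gt_eqF.
Qed.

Lemma ratio_cvg_pinfty : (cn alpha n / mun beta n) @[n --> \oo] --> +oo.
Proof.
have b0 : 0 < beta by case/andP: b01.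
have ab0 : 0 < alpha - beta by rewrite subr_gt0 beta_lt_alpha.
have a0 : 0 < alpha by exact: alpha_gt0.
have L0 : 0 < Gamma (beta + 1) / Gamma (alpha + 1) :> R.
  by rewrite divr_gt0// Gamma_gt0// addr_gt0.
have rc := ratio_asymp; have poo := powR_cvg_pinfty ab0.
move: L0 rc; move: (Gamma (beta + 1) / _) => L L0 rc.
apply/cvgryPge => A; near=> n.
have n0 : 0 < n%:R :> R by rewrite ltr0n; near: n; exact: nbhs_infty_gt.
have pn : 0 < n%:R `^ (alpha - beta) :> R by exact: powR_gt0.
rewrite -[leRHS](divfK (lt0r_neq0 pn)).
apply: (@le_trans _ _ (L / 2 * n%:R `^ (alpha - beta))).
  rewrite mulrC -ler_pdivrMr ?divr_gt0//; near: n.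
  exact: (cvgryPge _).1 poo _.
rewrite ler_wpM2r ?(ltW pn)// ltW//; near: n.
by apply: (cvgr_gt _ rc); rewrite ltr_pdivrMr// ltr_pMr// ltr1n.
Unshelve. all: by end_near. Qed.

Lemma scale_cvg0 : scale (mun beta) (cn alpha) n @[n --> \oo] --> (0 : R).
Proof.
have b0 : 0 < beta by case/andP: b01.
have a0 : 0 < alpha by exact: alpha_gt0.
have roo := ratio_cvg_pinfty.
have : (cn alpha n / mun beta n)^-1 @[n --> \oo] --> (0 : R).
  apply/gtr0_cvgV0 => //; near=> n.
  have n0 : (0 < n)%N by near: n; exact: nbhs_infty_gt.
  by rewrite divr_gt0//; [exact: mun_gt0 a0 n0|exact: mun_gt0 b0 n0].
by under eq_fun do rewrite invf_div.
Unshelve. all: by end_near. Qed.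

Lemma CstE : Cst p beta = kappa p beta * (Gamma (beta + 1) / Gamma (alpha + 1)).
Proof.
have a0 : 0 < alpha by exact: alpha_gt0.
have ab0 : 0 < alpha - beta by rewrite subr_gt0 beta_lt_alpha.
rewrite /Cst /kappa (GammaS a0); change (p * (beta + 1)) with alpha.
have := Gamma_gt0 a0; move: (Gamma alpha) (Gamma _) => x y x0.
move: alpha a0 ab0 => a a0 ab0.
by field; rewrite (gt_eqF ab0) !gt_eqF.
Qed.

End Gamma_weights.

(** * Measurability of the limit events *)

Section convergence_events.
Context {R : realType} {d : measure_display} {T : measurableType d}.
Variable f : nat -> T -> R.
Hypothesis mf : forall n, measurable_fun setT (f n).

Lemma measurable_norm_lt (g : T -> R) (e : R) : measurable_fun setT g ->
  measurable [set w | `|g w| < e].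
Proof.
move=> mg; rewrite (_ : mkset _ = setT `&` (Num.norm \o g) @^-1` `]-oo, e[%classic).
  by apply: (measurableT_comp (@normr_measurable _ _)) => //; exact: measurable_itv.
by rewrite setTI; apply/seteqP; split => w /=; rewrite in_itv.
Qed.

Lemma measurable_cvgn0 : measurable [set w | f n w @[n --> \oo] --> 0].
Proof.
rewrite (_ : mkset _ = \bigcap_j \bigcup_N \bigcap_(n in [set n | (N <= n)%N])
    [set w | `|f n w| < j.+1%:R^-1]).
  apply: bigcapT_measurable => j; apply: bigcupT_measurable => N.
  by apply: bigcap_measurable => [|n _]; [exists N => /=|exact: measurable_norm_lt].
apply/seteqP; split => w.
  by move=> /cvgn0P H j _; have [N HN] := H j; exists N.
move=> H; apply/cvgn0P => j; have [N _ HN] := H j I.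
by exists N => n; exact: HN.
Qed.

Lemma measurable_cvgn : measurable [set w | cvgn (fun n => f n w)].
Proof.
rewrite (_ : mkset _ = \bigcap_j \bigcup_N \bigcap_(n in [set n | (N <= n)%N])
    [set w | `|f n w - f N w| < j.+1%:R^-1]).
  apply: bigcapT_measurable => j; apply: bigcupT_measurable => N.
  apply: bigcap_measurable => [|n _]; first by exists N => /=.
  by apply: measurable_norm_lt; exact: measurable_funB.
apply/seteqP; split => w.
  by move=> /cvgn_cauchyP H j _; have [N HN] := H j; exists N.
move=> H; apply/cvgn_cauchyP => j; have [N _ HN] := H j I.
by exists N => n; exact: HN.
Qed.

Lemma measurable_bounded_below :
  measurable [set w | exists j N, forall n, (N <= n)%N -> j.+1%:R^-1 <= f n w].
Proof.
rewrite (_ : mkset _ = \bigcup_j \bigcup_N \bigcap_(n in [set n | (N <= n)%N])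
    (setT `&` f n @^-1` `[j.+1%:R^-1, +oo[%classic)).
  apply: bigcupT_measurable => j; apply: bigcupT_measurable => N.
  apply: bigcap_measurable => [|n _]; first by exists N => /=.
  by apply: mf => //; exact: measurable_itv.
apply/seteqP; split => w /=.
  move=> [j [N H]]; exists j => //; exists N => // n /= Nn.
  by split=> //; rewrite /= in_itv/= andbT H.
move=> [j _ [N _ H]]; exists j, N => n Nn.
by have [_] := H n Nn; rewrite /= in_itv/= andbT.
Qed.

End convergence_events.

Section limit_event.
Context {R : realType}.
Implicit Types (s m q : nat -> R).

(** The right-hand side does not mention the limit, so that it is visibly
    measurable. A divergent sequence has limit 0 by convention, which is why
    positivity of the limit implies convergence. *)
Lemma limit_eventP s m q (C : R) : 0 < C ->
  (0 < limn m /\ asymp_equiv s (fun n => C * limn m * q n)) <->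
  [/\ cvgn m,
      exists j N, forall n, (N <= n)%N -> j.+1%:R^-1 <= m n
    & s n / (C * q n) - m n @[n --> \oo] --> 0].
Proof.
move=> C0; split.
  move=> [l0 eqv].
  have cm : cvgn m.
    by apply: contrapT => /dvgP ml; move: l0; rewrite ml ltxx.
  move: l0 eqv; move/cvg_ex : (cm) => [l ml]; rewrite (cvg_lim (@Rhausdorff R) ml)// => l0 eqv.
  split=> //.
    have [j jl] := ltr_inv_nat l0; exists j.
    have /cvgr_gt/(_ _ jl) [N _ HN] := ml.
    by exists N => n Nn; apply/ltW; exact: HN.
  rewrite -(subrr l); apply: cvgB => //.
  rewrite -[X in _ --> X]mulr1.
  apply: (@eq_pos_cvg _ _ (fun n => l * (s n / (C * l * q n)))); last exact: cvgMr.
  move=> n _; rewrite !invfM.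
  rewrite (_ : l * _ = l / l * (s n * (C^-1 * (q n)^-1))); last by ring.
  by rewrite divff ?mul1r// gt_eqF.
move=> [cm [j [N mN]] H].
move/cvg_ex : (cm) => [l ml]; rewrite (cvg_lim (@Rhausdorff R) ml)//.
have l0 : 0 < l.
  apply: (@lt_le_trans _ _ j.+1%:R^-1); first by rewrite invr_gt0.
  by rewrite -(cvg_lim (@Rhausdorff R) ml)//; apply: limr_ge => //; exists N.
split=> //; rewrite /asymp_equiv -(divff (lt0r_neq0 l0)).
apply: (@eq_pos_cvg _ _ (fun n => (s n / (C * q n) - m n + m n) / l)).
  by move=> n _; rewrite subrK !invfM; ring.
by apply: cvgMl; rewrite -[X in _ --> X]add0r; apply: cvgD.
Qed.

End limit_event.

Section path.
Context {R : realType} {d : measure_display} {T : measurableType d}.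
Context (P : probability T R) (p beta : R).
Context (memory : nat -> {RV P >-> nat}) (coin : nat -> {RV P >-> bool}).
Context (X : nat -> {RV P >-> nat}).

Lemma Sn_real n w : (Sn X n w)%:R = \sum_(1 <= k < n.+1) (X k w)%:R :> R.
Proof. by rewrite /Sn natr_sum. Qed.

Lemma Sn_le m n w : (m <= n)%N -> (Sn X m w <= Sn X n w)%N.
Proof.
move=> mn; rewrite /Sn [leqRHS](@big_cat_nat _ _ _ m.+1)//=.
exact: leq_addr.
Qed.

(** The steps are natural numbers, so that a sum with infinitely many positive
    terms diverges and any other one is eventually constant. *)
Lemma SinftyE w : Sinfty R X w = +oo%E <-> infinitely_often X w.
Proof.
split.
  apply: contraPP => /existsNP[N HN].
  have S_cst n : (N <= n)%N -> Sn X n w = Sn X N w.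
    move=> Nn; rewrite -(subnKC Nn); elim: (n - N)%N => [|i IH]; first by rewrite addn0.
    rewrite addnS -IH /Sn big_nat_recr//=; apply/eqP; rewrite -[X in _ == X]addn0 eqn_add2l -leqn0 leqNgt.
    apply/negP => Xpos; apply: HN; exists (N + i).+1 => //.
    by rewrite leqW// leq_addr.
  rewrite /Sinfty (_ : limn _ = ((Sn X N w)%:R : R)%:E)//.
  apply/cvg_lim => //; apply: cvg_near_cst; exists N => // n /= Nn.
  by rewrite S_cst.
move=> io; apply/cvg_lim => //.
have S_big (k : nat) : exists n, (k <= Sn X n w)%N.
  elim: k => [|k [n kn]]; first by exists 0%N.
  have [m nm Xm] := io n.+1; exists m.
  case: m nm Xm => // m nm Xm; rewrite /Sn big_nat_recr//= -addn1.
  by apply: leq_add => //; apply: leq_trans kn _; exact: Sn_le.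
apply/cvgeryP/cvgryPge => A.
have [n kn] := S_big (Num.trunc `|A|).+1.
exists n => // m /= nm; apply: le_trans (ler_norm A) _.
apply: ltW; apply: lt_le_trans (truncnS_gt _) _.
by rewrite ler_nat; apply: leq_trans kn _; exact: Sn_le.
Qed.

Lemma measurable_Sinfty : measurable [set w | Sinfty R X w = +oo%E].
Proof.
rewrite (_ : mkset _ = \bigcap_N \bigcup_(n in [set n | (N <= n)%N])
    (X n @^-1` [set k | (0 < k)%N])).
  apply: bigcapT_measurable => N; apply: bigcup_measurable => n _.
  exact: measurable_funPTI.
apply/seteqP; split => w /=.
  by move=> /SinftyE io N _; have [n] := io N; exists n.
by move=> H; apply/SinftyE => N; have [n] := H N I; exists n.
Qed.

Lemma measurable_real k : measurable_fun setT (fun w => (X k w)%:R : R).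
Proof.
move=> _ B mB; rewrite setTI.
exact: (measurable_funPTI (X k) (Y := [set i | B i%:R])).
Qed.

Lemma measurable_Sn n : measurable_fun setT (fun w => (Sn X n w)%:R : R).
Proof.
rewrite (_ : (fun w => _) = (fun w => \sum_(1 <= k < n.+1) (X k w)%:R)); last first.
  by apply/funext => w; exact: Sn_real.
apply: measurable_sum => k; exact: measurable_real.
Qed.

Lemma measurable_Mn n : measurable_fun setT (Mn p beta X n).
Proof.
apply: measurable_funM => //; apply: measurable_sum => k.
by apply: measurable_funM => //; exact: measurable_real.
Qed.

Hypothesis walk1 : forall w, X 1%N w = 1%N.

Lemma walk_le1 n w : recursive memory coin X w -> (0 < n)%N -> (X n w <= 1)%N.
Proof.
move=> rec; elim/ltn_ind: n => -[//|[|n]] IH _; first by rewrite walk1.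
have [-> /andP[m0 mn]] := rec n.+1 isT; case: ifP => // _.
exact: IH.
Qed.

Lemma Sigman_hist n w : recursive memory coin X w ->
  Sigman beta X n w = wsum (mun beta) (hist X n w).
Proof.
move=> rec; rewrite /Sigman; elim: n => [|n IH]; first by rewrite big_geq.
rewrite big_nat_recr//= IH size_hist; congr (_ + _ * _).
have := walk_le1 rec (ltn0Sn n); by case: (X n.+1 w) => [|[]].
Qed.

Lemma Mn_hist n w : recursive memory coin X w ->
  Mn p beta X n w = mart (mun beta) (cn (alpha p beta)) (hist X n w).
Proof. by move=> rec; rewrite /Mn (Sigman_hist _ rec) /mart size_hist. Qed.

End path.

(** * Survival and growth *)

Section survival.
Context {R : realType} {d : measure_display} {T : measurableType d}.
Context (P : probability T R) (p beta : R).
Context (memory : nat -> {RV P >-> nat}) (coin : nat -> {RV P >-> bool}).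
Context (X : nat -> {RV P >-> nat}).
Hypotheses (p01 : 0 < p < 1) (b01 : 0 < beta < p / (1 - p)).
Hypothesis EW : elephant_walk p beta memory coin X.

Local Notation alpha := (alpha p beta).
Local Notation mu := (mun beta).
Local Notation c := (cn alpha).
Local Notation survives := [set w | Sinfty R X w = +oo%E].
Local Notation mart := (mart mu c).

Let b0 : 0 < beta. Proof. by case/andP: b01. Qed.
Let a0 : 0 < alpha. Proof. exact: alpha_gt0. Qed.
Let Hmu : rising beta mu. Proof. exact: rising_mun. Qed.
Let Hc : rising alpha c. Proof. exact: (rising_mun a0). Qed.
Let X1 : forall w, X 1%N w = 1%N. Proof. by case: EW. Qed.

Let step n v : (0 < n)%N ->
  P [set w | hist X n.+1 w = true :: v] =
    ((pstep p beta mu v)%:E * P [set w | hist X n w = v])%E /\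
  P [set w | hist X n.+1 w = false :: v] =
    ((1 - pstep p beta mu v)%:E * P [set w | hist X n w = v])%E.
Proof. by case: EW => ml cl ind w1 wS; exact: (hist_step ml cl ind w1 wS). Qed.

Let ae_rec : {ae P, forall w, recursive memory coin X w}.
Proof. by case: EW => ml _ _ _ wS; exact: (ae_recursive ml wS). Qed.

(** With positive probability all steps but the first are 0. *)
Lemma survival_lt1 : (P survives < 1)%E.
Proof.
have mB := @measurable_Sinfty R d T P X.
pose L := \bigcap_n [set w | hist X n.+1 w = lonely n].
have L0 : (0 < P L)%E.
  apply: (@lonely_gt0 R d T P p beta mu X p01 b01 Hmu X1 step).
  exact: mun_cvg_pinfty.
have mL : measurable L by apply: bigcapT_measurable => n; exact: measurable_hist.
have : (P L <= P (~` survives))%E.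
  apply: le_measure; [exact/mem_set|exact/mem_set/measurableC|].
  move=> w Lw; apply/SinftyE => io; have [[|[|n]] // _ Xn] := io 2%N.
  by have /= := Lw n.+1 I => -[]; rewrite Xn.
rewrite probability_setC// => /(lt_le_trans L0).
have : P survives \is a fin_num by rewrite fin_num_measure.
by move/fineK => <-; rewrite -EFinB !lte_fin subr_gt0.
Qed.

(** If the walk stops, the weighted sum is eventually constant and the martingale
    tends to 0, so it falls below half of its initial value 1; this has
    probability at most [theta]. *)
Lemma survival_gt0 : (0 < P survives)%E.
Proof.
have mB := @measurable_Sinfty R d T P X.
have D : (P (reaches X (ruin p beta mu c 1) 1) <= (theta p beta)%:E)%E.
  exact: (@dies_le R d T P p beta mu c X p01 b01 Hmu Hc X1 step).
have : (P (~` survives) <= (theta p beta)%:E)%E.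
  apply: le_trans D; apply: le_measure.
  - exact/mem_set/measurableC.
  - exact/mem_set/measurable_reaches.
  move=> w /SinftyE /existsNP[N HN].
  have wE n : (N <= n)%N -> wsum mu (hist X n w) = wsum mu (hist X N w).
    move=> Nn; rewrite -(subnKC Nn); elim: (n - N)%N => [|i IH]; first by rewrite addn0.
    rewrite addnS -IH /= (_ : (0 < _)%N = false) ?mulr0 ?addr0//.
    apply/negbTE/negP => Xpos; apply: HN; exists (N + i).+1 => //.
    by rewrite leqW// leq_addr.
  have /cvgryPge/(_ (2 * wsum mu (hist X N w))) [m _ Hm] := mun_cvg_pinfty a0.
  exists (maxn m N); apply: ruin_ge1 => //.
  rewrite /mart wE; last by rewrite leqW// leq_maxr.
  have cp : 0 < c (maxn m N).+1 by exact: (c_gt0 p01 b01 Hc).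
  rewrite size_hist ler_pdivrMr//.
  have /= := Hm (maxn m N).+1; rewrite leqW ?leq_maxl// => /(_ isT).
  change (mun alpha (maxn m N).+1) with (c (maxn m N).+1).
  by move: (wsum _ _) (cn _ _) => x y; lra.
rewrite probability_setC//.
have : P survives \is a fin_num by rewrite fin_num_measure.
move/fineK => <-; rewrite -EFinB lee_fin lte_fin.
by have := theta_lt1 p01 b01; lra.
Qed.

Let growth : set T := [set w | 0 < Minfty p beta X w /\
  asymp_equiv (fun n => (Sn X n w)%:R)
    (fun n => Cst p beta * Minfty p beta X w *
       n%:R `^ (p * (beta + 1) - beta))].

Let rate n : R := n%:R `^ (p * (beta + 1) - beta).

Lemma Cst_gt0 : 0 < Cst p beta.
Proof.
rewrite CstE//; apply: mulr_gt0; first exact: kappa_gt0.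
by rewrite divr_gt0// Gamma_gt0// addr_gt0.
Qed.

Lemma measurable_growth : measurable growth.
Proof.
pose M n w := Mn p beta X n w.
have mM n : measurable_fun setT (M n) by exact: measurable_Mn.
rewrite (_ : growth = [set w | cvgn (fun n => M n w)] `&`
   ([set w | exists j N, forall n, (N <= n)%N -> j.+1%:R^-1 <= M n w] `&`
    [set w | (Sn X n w)%:R / (Cst p beta * rate n) - M n w @[n --> \oo] --> 0])).
  apply: measurableI; first exact: measurable_cvgn.
  apply: measurableI; first exact: measurable_bounded_below.
  apply: measurable_cvgn0 => n; apply: measurable_funB => //.
  by apply: measurable_funM => //; exact: measurable_Sn.
apply/seteqP; split => w.
  by move=> /(limit_eventP _ _ _ Cst_gt0) [].
by move=> [? [? ?]]; apply/(limit_eventP _ _ _ Cst_gt0).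
Qed.

(** Away from null events this is deterministic: [cvg_sum_of_weighted] carries
    the convergence of the martingale over to the sums of the steps. *)
Lemma growth_of_cvg w : recursive memory coin X w ->
  cvgn (fun n => mart (hist X n w)) ->
  ~ (mart (hist X n w) @[n --> \oo] --> 0) -> growth w.
Proof.
move=> rec cM nM0.
have ME : (fun n => mart (hist X n w)) = (fun n => Mn p beta X n w).
  by apply/funext => n; rewrite (Mn_hist _ _ X1 _ rec).
rewrite ME in cM nM0; case/cvg_ex : (cM) => l Ml.
have lE : Minfty p beta X w = l by apply: cvg_lim.
have l_ge0 : 0 <= l.
  rewrite -lE; apply: (limr_ge cM); exists 1%N => // n n1.
  rewrite (Mn_hist _ _ X1 _ rec); apply: (mart_ge0 p01 b01 Hmu Hc).
  by rewrite size_hist.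
have l0 : 0 < l.
  by rewrite lt_neqAle l_ge0 andbT; apply/eqP => l00; apply: nM0; rewrite l00.
rewrite /growth/= lE; split=> //.
have roo := ratio_cvg_pinfty p01 b01.
have ra := ratio_asymp p01 b01.
have H := cvg_sum_of_weighted p01 b01 Hmu Hc roo Ml.
have C0 := Cst_gt0.
rewrite /asymp_equiv -[X in _ --> X](divff (lt0r_neq0 (mulr_gt0 C0 l0))).
apply: (@eq_pos_cvg _ _ (fun n => (\sum_(1 <= k < n.+1) (X k w)%:R) / (c n / mu n) *
   ((c n / mu n) / n%:R `^ (alpha - beta)) / (Cst p beta * l))); last first.
  apply: cvgMl.
  rewrite [X in _ --> X](_ : _ = kappa p beta * l * (Gamma (beta + 1) / Gamma (alpha + 1))).
    exact: cvgM H ra.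
  by rewrite (CstE p01 b01); move: (Gamma _) (Gamma _) => x y; ring.
move=> n n0; rewrite Sn_real.
have r0 : 0 < c n / mu n.
  by apply: divr_gt0; [exact: (c_gt0 p01 b01 Hc)|exact: (mu_gt0 b01 Hmu)].
move: r0; move: (c n / mu n) => r r0.
by rewrite mulrA (divfK (lt0r_neq0 r0)) invfM -!mulrA; congr (_ * _); rewrite mulrC.
Qed.

Lemma ae_growth : {ae P, forall w, survives w -> growth w}.
Proof.
have ae1 := @ae_cvg_mart R d T P p beta mu c X p01 b01 Hmu Hc X1 step (scale_cvg0 p01 b01).
have ae2 := @ae_escape R d T P p beta mu c X p01 b01 Hmu Hc X1 step.
apply: filterS3 ae_rec ae1 ae2 => w rec cM esc /SinftyE io.
by apply: growth_of_cvg => //; exact: esc.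
Qed.

Lemma growth_given_survival : cond_prob P growth survives = 1.
Proof.
have mB := @measurable_Sinfty R d T P X.
rewrite /cond_prob (_ : P (growth `&` survives) = P survives).
  have : P survives \is a fin_num by rewrite fin_num_measure.
  move=> /fineK fB; rewrite divff// gt_eqF//.
  by rewrite -lte_fin fB survival_gt0.
apply: ae_measure_eq => //; first by apply: measurableI => //; exact: measurable_growth.
by apply: filterS ae_growth => w gw; split=> [[]//|sw]; split=> //; exact: gw.
Qed.

End survival.

Theorem mainTheorem2 (R : realType) (d : measure_display)
    (T : measurableType d) (P : probability T R) (p beta : R)
    (memory : nat -> {RV P >-> nat}) (coin : nat -> {RV P >-> bool})
    (X : nat -> {RV P >-> nat}) :
  0 < p < 1 -> 0 < beta < p / (1 - p) ->
  elephant_walk p beta memory coin X ->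
  (0 < P [set w | Sinfty R X w = +oo] < 1)%E /\
  cond_prob P
    [set w | 0 < Minfty p beta X w /\
       asymp_equiv (fun n => (Sn X n w)%:R)
         (fun n => Cst p beta * Minfty p beta X w *
                   n%:R `^ (p * (beta + 1) - beta))]
    [set w | Sinfty R X w = +oo%E] = 1.
Proof.
move=> p01 b01 EW; split; last exact: growth_given_survival p01 b01 EW.
by rewrite (survival_gt0 p01 b01 EW) (survival_lt1 p01 b01 EW).
Qed.
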